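(* The paw-free completion problem admits a kernel with at most $38k$ vertices: there is a polynomial-time algorithm that, given an instance $(G,k)$ of Paw-free Completion, outputs an instance $(G^*,k^* )$ of Paw-free Completion with $k^*\le k$ and $|V(G^* )|\le 38k$ such that $(G,k)$ is a yes-instance if and only if $(G^*,k^* )$ is a yes-instance.
   Context: All graphs are finite, simple and undirected. A paw is the four-vertex graph with one vertex of degree three, two vertices of degree two and one vertex of degree one (a triangle plus a pendant edge attached to one triangle vertex). A graph is paw-free if it has no induced subgraph isomorphic to the paw. Paw-free Completion: given a graph $G$ and a nonnegative integer $k$, decide whether there is a set $E_+$ of at most $k$ non-edges of $G$ such that $G+E_+$ (the graph on $V(G)$ with edge set $E(G)\cup E_+$) is paw-free.
   Formalization: For no-instances with k = 0 the bound |V(G* )| ≤ 38k = 0 is impossible (for G the paw, the empty graph G* would be a yes-instance); in that case only, the formal statement requires |V(G* )| ≤ 4 instead. *)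

(* Defs.v *)
From mathcomp Require Import all_boot.
Set Implicit Arguments.
Unset Strict Implicit.
Unset Printing Implicit Defensive.

Record sgraph := SGraph {
  svertex :> finType;
  sedge : rel svertex;
  sedge_sym : symmetric sedge;
  sedge_irrefl : irreflexive sedge }.

Definition graph_iso (G H : sgraph) : Prop :=
  exists2 f : G -> H, bijective f & forall x y, sedge (f x) (f y) = sedge x y.

Section Induced.
Variables (G : sgraph) (S : {set G}).

Definition induced_rel : rel {x : G | x \in S} :=
  fun x y => sedge (val x) (val y).

Lemma induced_sym : symmetric induced_rel.
Proof. by move=> x y; rewrite /induced_rel sedge_sym. Qed.

Lemma induced_irrefl : irreflexive induced_rel.
Proof. by move=> x; rewrite /induced_rel sedge_irrefl. Qed.

Definition induced : sgraph := SGraph induced_sym induced_irrefl.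
End Induced.

Definition paw_rel : rel 'I_4 := fun i j =>
  let E := [:: (0, 1); (0, 2); (1, 2); (0, 3)] in
  ((i : nat, j : nat) \in E) || ((j : nat, i : nat) \in E).

Lemma paw_sym : symmetric paw_rel.
Proof. by move=> i j; rewrite /paw_rel orbC. Qed.

Lemma paw_irrefl : irreflexive paw_rel.
Proof. by case=> [[|[|[|[|m]]]] lt_m4]. Qed.

Definition paw : sgraph := SGraph paw_sym paw_irrefl.

Definition paw_free (G : sgraph) : Prop :=
  ~ exists S : {set G}, graph_iso (induced S) paw.

Definition nonedges (G : sgraph) : {set {set G}} :=
  [set [set p.1; p.2] | p : G * G & (p.1 != p.2) && ~~ sedge p.1 p.2].

Section AddEdges.
Variables (G : sgraph) (F : {set {set G}}).

Definition add_edges_rel : rel G :=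
  fun x y => sedge x y || (x != y) && ([set x; y] \in F).

Lemma add_edges_sym : symmetric add_edges_rel.
Proof. by move=> x y; rewrite /add_edges_rel sedge_sym eq_sym setUC. Qed.

Lemma add_edges_irrefl : irreflexive add_edges_rel.
Proof. by move=> x; rewrite /add_edges_rel sedge_irrefl eqxx. Qed.

Definition add_edges : sgraph := SGraph add_edges_sym add_edges_irrefl.
End AddEdges.

Definition instance : Type := sgraph * nat.

Definition yes_instance (I : instance) : Prop :=
  exists F : {set {set I.1}},
    [/\ F \subset nonedges I.1, #|F| <= I.2 & paw_free (add_edges F)].

(** The machine model is the WHILE language over binary trees (N. D. Jones,
    Computability and Complexity from a Programming Perspective, MIT Press,
    1997).  Every evaluated subexpression is charged the full size of its
    value, so that the size of all data in the store is bounded by the initial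
    size plus the running time; running times are then polynomially related to
    those of Turing machines, for computing functions as well as for
    deciding. *)

Inductive tree := Leaf | Node of tree & tree.

Fixpoint tsize (t : tree) : nat :=
  if t is Node a b then (tsize a + tsize b).+1 else 1.

Inductive expr :=
  | Var of nat
  | Nil
  | Cons of expr & expr
  | Hd of expr
  | Tl of expr.

Inductive cmd :=
  | Skip
  | Assign of nat & expr
  | Seq of cmd & cmd
  | If of expr & cmd & cmd
  | While of expr & cmd.

Definition store := nat -> tree.

Definition upd (s : store) (x : nat) (v : tree) : store :=
  fun y => if y == x then v else s y.

Fixpoint eval (s : store) (e : expr) : tree :=
  match e with
  | Var x => s x
  | Nil => Leaf
  | Cons a b => Node (eval s a) (eval s b)
  | Hd a => if eval s a is Node u _ then u else Leaf
  | Tl a => if eval s a is Node _ v then v else Leaf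
  end.

Fixpoint ecost (s : store) (e : expr) : nat :=
  tsize (eval s e) +
  match e with
  | Var _ | Nil => 0
  | Cons a b => ecost s a + ecost s b
  | Hd a | Tl a => ecost s a
  end.

(* [exec c s t s']: started in store [s], the command [c] terminates in store
   [s'] after time [t].  As a condition, [Leaf] means false, [Node] true. *)
Inductive exec : cmd -> store -> nat -> store -> Prop :=
  | ExecSkip s :
      exec Skip s 1 s
  | ExecAssign s x e :
      exec (Assign x e) s (ecost s e) (upd s x (eval s e))
  | ExecSeq c1 c2 s s1 s2 t1 t2 :
      exec c1 s t1 s1 -> exec c2 s1 t2 s2 ->
      exec (Seq c1 c2) s (t1 + t2) s2
  | ExecIfTrue e c1 c2 s s1 t :
      eval s e <> Leaf -> exec c1 s t s1 ->
      exec (If e c1 c2) s (ecost s e + t) s1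
  | ExecIfFalse e c1 c2 s s1 t :
      eval s e = Leaf -> exec c2 s t s1 ->
      exec (If e c1 c2) s (ecost s e + t) s1
  | ExecWhileFalse e c s :
      eval s e = Leaf ->
      exec (While e c) s (ecost s e) s
  | ExecWhileTrue e c s s1 s2 t1 t2 :
      eval s e <> Leaf -> exec c s t1 s1 -> exec (While e c) s1 t2 s2 ->
      exec (While e c) s (ecost s e + t1 + t2) s2.

(* Variable 0 holds the input at the start and the output at the end; all
   other variables are initially [Leaf]. *)
Definition computes (c : cmd) (input : tree) (t : nat) (output : tree) : Prop :=
  exists2 s, exec c (upd (fun=> Leaf) 0 input) t s & s 0 = output.

Definition polytime (A B : Type) (encA : A -> tree) (encB : B -> tree)
    (f : A -> B) : Prop :=
  exists (c : cmd) (a d : nat), forall x : A,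
    exists2 t, computes c (encA x) t (encB (f x))
             & t <= a * tsize (encA x) ^ d + a.

Definition enc_bool (b : bool) : tree := if b then Node Leaf Leaf else Leaf.

Definition enc_seq (A : Type) (enc : A -> tree) (s : seq A) : tree :=
  foldr (fun x t => Node (enc x) t) Leaf s.

(* Binary digits, least significant first; [up_log 2 n.+1] is the length of the
   binary representation of [n] (0 for [n = 0]). *)
Definition bits (n : nat) : seq bool :=
  mkseq (fun i => odd (n %/ 2 ^ i)) (up_log 2 n.+1).

Definition enc_nat (n : nat) : tree := enc_seq enc_bool (bits n).

Definition enc_graph (G : sgraph) : tree :=
  enc_seq (enc_seq enc_bool) [seq [seq sedge x y | y <- enum G] | x <- enum G].

Definition enc_instance (I : instance) : tree :=
  Node (enc_graph I.1) (enc_nat I.2).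

(* Main.v *)
(**
  A connected paw-free graph that contains a triangle is complete multipartite
  (Olariu).  Adding edges between components never helps, so triangle-free
  components can be dropped, and in the others the added edges must turn the
  complement, taken inside each component, into a disjoint union of cliques.
  Paw-free completion is thus cluster deletion on the graph of non-adjacent
  pairs inside the components that contain a triangle.

  For cluster deletion, splitting a clique [K] costs at least [#|K| - 1]
  deletions, so if fewer than [#|K|] edges leave [K], it is optimal to cut
  exactly these and to make [K] a cluster.  If this applies to no closed
  neighbourhood, every cluster [K] of a solution is incident to at least [#|K|]
  deleted edges, and there are at most [2 * k] vertices.  Complementing and
  adding two universal vertices, which force connectedness and a triangle, gives
  a completion instance with at most [2 * k + 2] vertices.
*)

Require Import Defs.
From mathcomp Require Import all_boot zify.

Set Implicit Arguments.
Unset Strict Implicit.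
Unset Printing Implicit Defensive.

(* [all_boot] has a [tsize] for tuples. *)
Local Notation tsize := Defs.tsize.

(** * Cluster deletion *)

(** The reduction to cluster deletion is used twice: on the input, and read backwards to turn what
    is left into a graph again. In between only a relation on numbers, a shrinking list and the
    budget spent are kept; components are computed once, so removing vertices cannot disturb them. A
    clustering is a colouring of a list, which restricts to sublists and extends by a fresh colour.

    Two obstacles shape the rest. The parameter arrives in binary and may be exponentially large, so
    it is capped by the square of the number of vertices before it becomes a unary number. And the
    running time is that of a concrete WHILE program: the algorithm is written with folds and
    bounded iterations over lists, and each loop needs a polynomial bound on its intermediate
    values.

    The size [2 * k + 2] fits in [38 * k] only for [k >= 1]. An input emptied by the reduction is
    answered by the empty graph, and a no-instance by a paw with budget zero, whose four vertices
    exceed the bound only when [k = 0]. *)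

Section ClusterDeletion.
Variables (T : eqType) (h : rel T).
Implicit Types (c : T -> nat) (S A B : seq T) (P : pred T).

Definition clustering S c :=
  {in S &, forall x y, c x = c y -> (y == x) || h x y}.

Definition splits c A B : nat :=
  \sum_(x <- A) \sum_(y <- B) (h x y && (c x != c y)).

(** For symmetric [h], [splits] sees every deleted edge in both orders, hence the doubled budget. *)
Definition cluster_deletion S k :=
  exists2 c, clustering S c & splits c S S <= k.*2.

Definition boundary S P : nat :=
  \sum_(x <- S | P x) \sum_(y <- S | ~~ P y) h x y.

Definition clique S := {in S &, forall x y, (y == x) || h x y}.

Hypothesis sym_h : symmetric h.

Lemma splits_sym c A B : splits c A B = splits c B A.
Proof.
rewrite /splits exchange_big /=; apply: eq_bigr => y _; apply: eq_bigr => x _.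
by rewrite sym_h eq_sym.
Qed.

Lemma splits_filter c P S :
  splits c S S = splits c (filter P S) (filter P S)
    + (splits c (filter P S) (filter (predC P) S)).*2
    + splits c (filter (predC P) S) (filter (predC P) S).
Proof.
have E x : \sum_(y <- S) (h x y && (c x != c y)) =
  \sum_(y <- filter P S) (h x y && (c x != c y)) +
  \sum_(y <- filter (predC P) S) (h x y && (c x != c y)).
  by rewrite (bigID P) /= !big_filter.
rewrite {1}/splits (bigID P) /= -big_filter -[X in _ + X]big_filter.
rewrite (eq_bigr _ (fun x _ => E x)) [X in _ + X](eq_bigr _ (fun x _ => E x)).
rewrite !big_split /= -!/(splits c _ _).
rewrite (splits_sym c [seq x <- S | predC P x] [seq x <- S | P x]).
by rewrite -addnn !addnA.
Qed.

Lemma splits_all c A B :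
  {in A & B, forall x y, h x y && (c x != c y)} ->
  splits c A B = size A * size B.
Proof.
move=> AB; rewrite /splits (eq_big_seq (fun=> size B)) => [|x xA].
  by rewrite big_const_seq count_predT iter_addn_0 mulnC.
rewrite (eq_big_seq (fun=> 1)) ?sum1_size // => y yB.
by rewrite AB.
Qed.

(* A clique of size m that is not monochromatic has two nonempty sides of
   sizes a + b = m, hence at least a * b >= m - 1 split edges. *)
Lemma splits_clique c S :
  clique S -> ~~ all2rel (fun x y => c x == c y) S ->
  (size S).-1.*2 <= splits c S S.
Proof.
move=> clS /allPn[x0 x0S /allPn[y0 y0S neq]].
pose P y := c y == c x0.
rewrite (splits_filter c P) addnAC; apply: leq_trans (leq_addl _ _).
rewrite leq_double splits_all => [|x y].
  have a0 : 0 < size (filter P S).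
    by rewrite size_filter -has_count; apply/hasP; exists x0; rewrite /P ?eqxx.
  have b0 : 0 < size (filter (predC P) S).
    rewrite size_filter -has_count; apply/hasP; exists y0 => //=.
    by rewrite /P eq_sym.
  have := count_predC P S; rewrite -!size_filter => <-.
  move: (size _) (size _) a0 b0 => a b; case: a => // a; case: b => // b _ _.
  by rewrite addSn /= mulSn addnC leq_add2l leq_pmulr.
rewrite !mem_filter /= /P => /andP[/eqP cx xS] /andP[ny yS].
rewrite cx eq_sym ny andbT; case/orP: (clS x y xS yS) => // /eqP yx.
by case/negP: ny; rewrite yx cx.
Qed.

Lemma boundaryE S P :
  boundary S P = \sum_(x <- filter P S) \sum_(y <- filter (predC P) S) h x y.
Proof.
by rewrite /boundary big_filter; apply: eq_bigr => x _; rewrite big_filter.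
Qed.

Lemma splits_le_boundary c S P :
  splits c (filter P S) (filter (predC P) S) <= boundary S P.
Proof.
rewrite boundaryE /splits; do 2 (apply: leq_sum => ? _).
by case: h => //=; case: eqP.
Qed.

(* If a vertex outside a monochromatic clique K had the colour of K, it would be
   adjacent to all of K and the boundary would have size at least |K|. *)
Lemma clique_removal S P k : clique (filter P S) ->
  boundary S P < size (filter P S) ->
  cluster_deletion S k <->
  boundary S P <= k /\ cluster_deletion (filter (predC P) S) (k - boundary S P).
Proof.
set K := filter P S; set Z := filter (predC P) S => clK small; split.
- case=> c cS cost; rewrite (splits_filter c P) -/K -/Z in cost.
  (* It is enough that the pairs meeting [K] pay for the boundary twice: the remaining cost is that
     of [c] on [Z]. *)
  suff H : (boundary S P).*2 <= splits c K K + (splits c K Z).*2.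
    split; first lia.
    exists c; last lia.
    by move=> x y; rewrite !mem_filter => /andP[_ xS] /andP[_ yS]; apply: cS.
  case: (boolP (all2rel (fun x y => c x == c y) K)) => [mono|].
    suff -> : splits c K Z = boundary S P by lia.
    rewrite boundaryE; apply: eq_big_seq => x xK; apply: eq_big_seq => y yZ.
    case: eqP => [cxy|_]; rewrite ?andbT // andbF; apply/esym/eqP.
    rewrite eqb0; apply/negP => _.
    have : size K <= boundary S P.
      rewrite boundaryE -sum1_size big_seq [X in _ <= X]big_seq.
      apply: leq_sum => z zK; rewrite (big_rem y) //=.
      apply: leq_trans (leq_addr _ _).
      have : (y == z) || h z y.
        apply: cS.
        - by move: zK; rewrite mem_filter => /andP[].
        - by move: yZ; rewrite mem_filter => /andP[].
        - by rewrite -cxy; apply/eqP; move/allrelP: mono; apply.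
      case/orP=> [/eqP yz|->] //.
      by move: zK yZ; rewrite yz !mem_filter /= => /andP[->].
    by rewrite leqNgt small.
  (* A split clique costs at least twice [size K - 1], and the boundary has at most [size K - 1]
     edges. *)
  move=> /(splits_clique clK); lia.
- case=> le_k [c cZ cost].
  (* A colour absent from [Z] makes [K] a class of its own, so split pairs either cross the boundary
     or lie in [Z]. *)
  pose fresh := (\max_(x <- Z) c x).+1.
  pose c' x := if P x then fresh else c x.
  have c'Z : {in Z, c' =1 c}.
    by move=> x; rewrite mem_filter /= /c' => /andP[/negbTE->].
  have cfresh x : x \in Z -> c x <> fresh.
    by move=> xZ; have := leq_bigmax_seq (F := c) x xZ isT; rewrite /fresh; lia.
  exists c'.
    move=> x y xS yS; case Px: (P x); case Py: (P y).
    + by move=> _; apply: clK; rewrite mem_filter ?Px ?Py.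
    + rewrite /c' Px Py => E; case: (@cfresh y) => //.
      by rewrite mem_filter /= Py.
    + rewrite /c' Px Py => E; case: (@cfresh x) => //.
      by rewrite mem_filter /= Px.
    + by rewrite /c' Px Py; apply: cZ; rewrite mem_filter /= ?Px ?Py.
  rewrite (splits_filter c' P) -/K -/Z.
  have -> : splits c' K K = 0.
    rewrite /splits big_seq big1 // => x; rewrite mem_filter => /andP[Px _].
    rewrite big_seq big1 // => y; rewrite mem_filter => /andP[Py _].
    by rewrite /c' Px Py eqxx andbF.
  have -> : splits c' Z Z = splits c Z Z.
    by apply: eq_big_seq => x xZ; apply: eq_big_seq => y yZ; rewrite !c'Z.
  have := splits_le_boundary c' S P; rewrite -/K -/Z; lia.
Qed.

Definition nbr u y := (y == u) || h u y.

(** Split pairs are charged to their first vertex, one colour class at a time. If every vertex of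
    the class has a split edge, the class pays one per vertex. Otherwise some [u] has none, so the
    class is exactly the closed neighbourhood of [u]; it is a clique, its boundary edges are all
    split, and irreducibility says that there are enough of them. *)
Lemma irreducible_small S k :
  (forall u, u \in S -> clique (filter (nbr u) S) ->
     size (filter (nbr u) S) <= boundary S (nbr u)) ->
  cluster_deletion S k -> size S <= k.*2.
Proof.
move=> irr [c cS cost]; apply: leq_trans cost.
pose cut x := \sum_(y <- S) (h x y && (c x != c y)).
(* Grouping a sum by colour needs a finite type of colours. *)
pose N := \max_(x <- S) c x; pose col x : 'I_N.+1 := inord (c x).
have colE x : x \in S -> col x = c x :> nat.
  by move=> xS; rewrite inordK // ltnS; apply: leq_bigmax_seq.
rewrite -sum1_size /splits (partition_big col xpredT) //=.
rewrite [X in _ <= X](partition_big col xpredT) //=.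
apply: leq_sum => a _.
case: (boolP (has (fun u => (col u == a) && (cut u == 0)) S)) => [|/hasPn pos].
  case/hasP=> u uS /andP[/eqP ua /eqP cut0].
  have nbrE y : y \in S -> nbr u y = (col y == a).
    move=> yS; rewrite -ua -val_eqE /= !colE //; apply/idP/eqP => [|E].
      case/orP=> [/eqP->//|huy]; apply/esym/eqP; apply: contraLR huy => neq.
      move: cut0; rewrite /cut (big_rem y) //= neq andbT.
      by move=> /eqP; rewrite addn_eq0 eqb0 => /andP[].
    by apply: cS.
  have /(irr u uS) : clique (filter (nbr u) S).
    move=> x y; rewrite !mem_filter => /andP[nx xS] /andP[ny yS].
    apply: cS => //; rewrite -!colE //.
    by move: nx ny; rewrite !nbrE // => /eqP-> /eqP->.
  rewrite size_filter -sum1_count /boundary big_seq_cond => le.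
  rewrite big_seq_cond (eq_bigl (fun i => (i \in S) && nbr u i)); last first.
    by move=> x; case xS: (x \in S) => //=; rewrite nbrE.
  apply: leq_trans le _; rewrite big_seq_cond [X in _ <= X]big_seq_cond.
  rewrite [X in _ <= X](eq_bigl (fun i => (i \in S) && nbr u i)); last first.
    by move=> x; case xS: (x \in S) => //=; rewrite nbrE.
  apply: leq_sum => x /andP[xS nx].
  rewrite [X in _ <= X](bigID (fun y => ~~ nbr u y)) /=.
  apply: leq_trans (leq_addr _ _).
  rewrite big_seq_cond [X in _ <= X]big_seq_cond.
  apply: leq_sum => y /andP[yS ny]; case: eqP => cxy; rewrite ?andbT //.
  case/negP: ny; move: nx; rewrite !nbrE // => /eqP<-.
  by rewrite -val_eqE /= !colE // cxy.
rewrite big_seq_cond [X in _ <= X]big_seq_cond.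
apply: leq_sum => x /andP[xS xa].
by have := pos x xS; rewrite xa /= -lt0n.
Qed.

(** No clustering splits more than [size S * size S] ordered pairs, so a larger budget is no
    stronger. This lets the binary parameter become a unary number. *)
Lemma cluster_deletion_cap S k m : size S * size S <= m ->
  cluster_deletion S (minn k m) <-> cluster_deletion S k.
Proof.
move=> Sm; split=> -[c cS cost]; exists c => //; first lia.
suff : splits c S S <= size S * size S by lia.
apply: (@leq_trans (\sum_(x <- S) size S)).
  apply: leq_sum => x _; rewrite -sum1_size.
  by apply: leq_sum => y _; case: andb.
by rewrite big_const_seq count_predT iter_addn_0.
Qed.

End ClusterDeletion.

Lemma cluster_deletion_map (T U : eqType) (f : T -> U) (h : rel T) (g : rel U)
    S k :
  injective f -> {in S &, forall x y, g (f x) (f y) = h x y} ->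
  cluster_deletion g (map f S) k <-> cluster_deletion h S k.
Proof.
move=> injf gE; split=> -[c cS cost].
  exists (c \o f).
    move=> x y xS yS cxy; rewrite -(inj_eq injf) -gE //.
    by apply: cS; rewrite ?map_f.
  apply: leq_trans cost; rewrite /splits big_map big_seq [X in _ <= X]big_seq.
  apply: leq_sum => x xS; rewrite big_map big_seq [X in _ <= X]big_seq.
  by apply: leq_sum => y yS; rewrite gE.
(* The position of [f x] in [map f S] is, by injectivity, that of [x] in [S], which replaces an
   inverse of [f]. *)
pose c' y := nth 0 (map c S) (index y (map f S)).
have c'E x : x \in S -> c' (f x) = c x.
  by move=> xS; rewrite /c' index_map // (nth_map x) ?nth_index ?index_mem.
exists c'.
  move=> _ _ /mapP[x xS ->] /mapP[y yS ->]; rewrite !c'E // => /(cS x y xS yS).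
  by rewrite (inj_eq injf) gE.
apply: leq_trans cost; rewrite /splits big_map big_seq [X in _ <= X]big_seq.
apply: leq_sum => x xS; rewrite big_map big_seq [X in _ <= X]big_seq.
by apply: leq_sum => y yS; rewrite gE // !c'E.
Qed.

(** * From paw-free completion to cluster deletion *)

Section Olariu.
Variables (T : finType) (e : rel T).
Hypothesis sym_e : symmetric e.

Definition no_paw := forall a b c d : T,
  e a b -> e a c -> e b c -> e a d -> d != b -> d != c -> e d b || e d c.

Definition on_triangle v := exists a b, [/\ e v a, e v b & e a b].

Definition in_triangle_component v := exists2 a, connect e v a & on_triangle a.

Hypothesis pf : no_paw.

Lemma on_triangle_adj v w : on_triangle v -> e v w -> on_triangle w.
Proof.
move=> [a [b [va vb ab]]] vw.
have [->|wa] := eqVneq w a; first by exists v, b; split; rewrite // sym_e.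
have [->|wb] := eqVneq w b.
  by exists v, a; split; rewrite // sym_e.
have wv : e w v by rewrite sym_e.
by case/orP: (pf va vb ab vw wa wb) => ?; [exists v, a|exists v, b]; split.
Qed.

Lemma edge_in_triangle v w : on_triangle v -> e v w ->
  exists t, e v t /\ e w t.
Proof.
move=> [a [b [va vb ab]]] vw.
have [->|wa] := eqVneq w a; first by exists b.
have [->|wb] := eqVneq w b; first by exists a; rewrite sym_e in ab.
by case/orP: (pf va vb ab vw wa wb) => ?; [exists a|exists b].
Qed.

Lemma component_on_triangle v : in_triangle_component v -> on_triangle v.
Proof.
move=> [a cva Ta].
have cl : connect_sym e by apply: sym_connect_sym.
rewrite cl in cva; case/connectP: cva => p + ->.
elim: p a Ta => //= w p IH a Ta /andP[aw]; apply: IH.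
exact: on_triangle_adj Ta aw.
Qed.

Lemma triangle_component_adj v w :
  in_triangle_component v -> e v w -> in_triangle_component w.
Proof.
move=> [a cva Ta] vw; exists a => //; apply: connect_trans cva.
by apply: connect1; rewrite sym_e.
Qed.

(** This is the core of Olariu's theorem, by induction along a path from [x]. Let [w] be a neighbour
    of a vertex [u] adjacent to the end [a] of an edge [a b], and suppose that [w] misses both ends.
    Then [u] and [b] are not adjacent, or [w] would be pendant on [u a b]. With [t] completing a
    triangle on [u a], paw-freeness forces the edges [w t] and [b t], and [w] is pendant on
    [t a b]. *)
Lemma edge_dominates x z y :
  in_triangle_component x -> e x z -> connect e x y ->
  e y x || e y z.
Proof.
move=> Cx xz /connectP[p pth ->].
have xd : e x x || e x z by rewrite xz orbT.
elim/last_ind: p pth => // p w IH; rewrite rcons_path last_rcons => /andP[pp].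
move: (last x p) (IH pp) (path_connect pp (mem_last x p)) => u Du cxu uw.
have {IH pp} Cu : in_triangle_component u.
  case: Cx => a cxa Ta; exists a => //.
  have cl : connect_sym e by apply: sym_connect_sym.
  by apply: connect_trans cxa; rewrite cl.
have Cz := triangle_component_adj Cx xz.
have key a b : in_triangle_component a -> e a b -> e u a -> e w a || e w b.
  move=> Ca ab ua; apply/negPn/negP; rewrite negb_or => /andP[wa wb].
  have wu : e w u by rewrite sym_e.
  have [wea|wna] := eqVneq w a; first by rewrite wea ab in wb.
  have [web|wnb] := eqVneq w b; first by rewrite web sym_e ab in wa.
  have [ub|nub] := boolP (e u b).
    by have := pf ua ub ab uw wna wnb; rewrite (negbTE wa) (negbTE wb).
  have [t [ut at_]] := edge_in_triangle (component_on_triangle Cu) ua.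
  have tb : t != b by apply: contraNneq nub => <-.
  have wt : e w t.
    have [wet|wnt] := eqVneq w t; first by rewrite sym_e wet at_ in wa.
    have := pf ua ut at_ uw wna wnt; rewrite (negbTE wa) /=.
    by [].
  have ub' : u != b by apply: contraNneq wb => <-.
  have bt : e b t.
    have := pf (a := a) (b := u) (c := t) (d := b).
    rewrite sym_e ua at_ ut ab eq_sym ub' eq_sym tb.
    move=> /(_ isT isT isT isT isT isT).
    by rewrite sym_e (negbTE nub).
  have := pf (a := t) (b := a) (c := b) (d := w).
  rewrite sym_e at_ (sym_e t b) bt ab (sym_e t w) wt wna wnb.
  by move=> /(_ isT isT isT isT isT isT); rewrite (negbTE wa) (negbTE wb).
case/orP: Du => [ux|uz]; first exact: key.
by rewrite orbC; apply: key => //; rewrite sym_e.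
Qed.

(** An edge [x z] would have to dominate [y]. Non-adjacency is thus an equivalence on the component,
    and its classes are the parts of the complete multipartite graph. *)
Lemma nonadj_trans x y z : in_triangle_component x ->
  connect e x y -> ~~ e x y -> ~~ e y z -> ~~ e x z.
Proof.
move=> Cx cxy xy yz; apply/negP => xz.
have := edge_dominates Cx xz cxy.
by rewrite sym_e (negbTE xy) (negbTE yz).
Qed.

End Olariu.

Lemma paw_freeP (G : sgraph) : paw_free G <-> no_paw (@sedge G).
Proof.
split=> [pf a b c d ab ac bc ad db dc|pf [S [f [g fK gK] fE]]].
  apply/negPn/negP; rewrite negb_or => /andP[ndb ndc]; apply: pf.
  have irr := @sedge_irrefl G.
  have ne (x y : G) : sedge x y -> x != y.
    by apply: contraTneq => ->; rewrite irr.
  (* The order follows the labels of the paw: [a] has degree three and [d] degree one. *)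
  pose L := [:: a; b; c; d].
  have uL : uniq L.
    by rewrite /= !inE !negb_or ne // ne // ne // ne // ![_ == d]eq_sym db dc.
  pose S := [set x in L].
  have idxS (x : {x | x \in S}) : index (val x) L < 4.
    by have := valP x; rewrite inE -index_mem.
  pose f (x : induced S) : paw := Ordinal (idxS x).
  have memL (i : 'I_4) : nth a L i \in S.
    by rewrite inE mem_nth //=.
  pose g (i : paw) : induced S := exist _ (nth a L i) (memL i).
  have fK : cancel f g.
    move=> x; apply: val_inj; rewrite /= nth_index //.
    by have := valP x; rewrite inE.
  have gK : cancel g f.
    move=> i; apply: (@ord_inj 4).
    exact: (@index_uniq G a i L (ltn_ord i) uL).
  exists S; exists f; first by exists g.
  move=> x y; rewrite -{2}(fK x) -{2}(fK y).
  move: (f x) (f y) => i j; rewrite /= /induced_rel /=.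
  have sE := @sedge_sym G.
  case: i => [[|[|[|[|i]]]] //= lti]; case: j => [[|[|[|[|j]]]] //= ltj];
   rewrite /paw_rel /= ?inE /= ?irr //; apply/esym;
   rewrite ?(ab, ac, bc, ad) //; try (by rewrite sE ?(ab, ac, bc, ad));
   apply/negbTE; rewrite // sE //.
pose v i : G := val (g i).
have vE (i j : paw) : sedge (v i) (v j) = paw_rel i j.
  by rewrite -[RHS]/(sedge i j) -{2}(gK i) -{2}(gK j) fE.
have vI : injective v by move=> i j /val_inj/(can_inj gK).
pose o k (H : k < 4) : paw := Ordinal H.
have := pf (v (o 0 isT)) (v (o 1 isT)) (v (o 2 isT)) (v (o 3 isT)).
by rewrite !vE !(inj_eq vI) => /(_ isT isT isT isT isT isT).
Qed.

(** * Edge sets as sets of unordered pairs *)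

Definition pair_sets (T : finType) (r : rel T) : {set {set T}} :=
  [set [set p.1; p.2] | p : T * T & r p.1 p.2].

Lemma mem_pair_sets (T : finType) (r : rel T) x y :
  symmetric r -> ([set x; y] \in pair_sets r) = r x y.
Proof.
move=> sr; apply/imsetP/idP => [[[a b]]|rxy]; last first.
  by exists (x, y); rewrite ?inE.
rewrite inE /= => rab E.
have xI : x \in [set a; b] by rewrite -E set21.
have yI : y \in [set a; b] by rewrite -E set22.
have aI : a \in [set x; y] by rewrite E set21.
have bI : b \in [set x; y] by rewrite E set22.
move: xI yI aI bI; rewrite !inE.
move=> /orP[]/eqP-> /orP[]/eqP->; rewrite ?orbb ?[r b a]sr //.
  by move=> _ /eqP ba; rewrite -{2}ba.
by move=> /eqP ab _; rewrite -{1}ab.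
Qed.

(** Each member of [pair_sets r] arises from exactly two ordered pairs, distinct by irreflexivity;
    this turns the ordered counts of [splits] into numbers of edges. *)
Lemma card_pair_sets (T : finType) (r : rel T) :
  symmetric r -> irreflexive r ->
  \sum_x \sum_y r x y = (#|pair_sets r|).*2.
Proof.
move=> sr ir; rewrite pair_big /=.
transitivity (\sum_(p in [set p : T * T | r p.1 p.2]) 1).
  rewrite [RHS](eq_bigl (fun p => r p.1 p.2)) => [|p]; last by rewrite inE.
  by rewrite [RHS]big_mkcond; apply: eq_bigr => p _; case: (r _ _).
rewrite (partition_big_imset (fun p : T * T => [set p.1; p.2])) /=.
rewrite -muln2 -sum_nat_const; apply: eq_bigr => A /imsetP[[x y]].
rewrite inE /= => rxy ->.
have nxy : x != y by apply: contraTneq rxy => ->; rewrite ir.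
rewrite sum1_card -(_ : #|[set (x, y); (y, x)]| = 2); last first.
  by rewrite cards2 xpair_eqE negb_and nxy.
apply: eq_card => -[a b]; rewrite !inE !xpair_eqE unfold_in /= inE /=.
apply/andP/idP => [[rab /eqP E]|].
  have aI : a \in [set x; y] by rewrite -E set21.
  have bI : b \in [set x; y] by rewrite -E set22.
  have nab : a != b by apply: contraTneq rab => ->; rewrite ir.
  move: aI bI nab; rewrite !inE => /orP[]/eqP-> /orP[]/eqP->; rewrite ?eqxx //.
  by rewrite orbT.
case/orP=> /andP[/eqP-> /eqP->]; first by rewrite rxy eqxx.
by rewrite sr rxy setUC eqxx.
Qed.

Section Reduction.
Variable G : sgraph.
Implicit Types x y z : G.

Let e : rel G := @sedge G.

Definition in_triangle_componentb : pred G := fun v =>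
  [exists a, connect e v a && [exists b, exists c, [&& e a b, e a c & e b c]]].

Lemma in_triangle_componentP v :
  reflect (in_triangle_component e v) (in_triangle_componentb v).
Proof.
apply: (iffP existsP) => [[a /andP[va /existsP[b /existsP[c]]]]|].
  by case/and3P=> ab ac bc; exists a => //; exists b, c.
case=> a va [b [c [ab ac bc]]]; exists a; rewrite va.
by apply/existsP; exists b; apply/existsP; exists c; rewrite ab ac.
Qed.

Definition component_nonadj : rel G :=
  fun x y => [&& connect e x y, ~~ e x y & x != y].

Definition triangle_vertices : seq G :=
  [seq v <- enum G | in_triangle_componentb v].

Let conn_sym : connect_sym e := sym_connect_sym (@sedge_sym G).

Lemma component_nonadj_sym : symmetric component_nonadj.
Proof.
by move=> x y; rewrite /component_nonadj conn_sym eq_sym /e sedge_sym.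
Qed.

Let split_rel (c : G -> nat) : rel G := fun x y =>
  [&& in_triangle_componentb x, in_triangle_componentb y,
      component_nonadj x y & c x != c y].

Let split_rel_sym c : symmetric (split_rel c).
Proof.
move=> x y; rewrite /split_rel component_nonadj_sym [c x == _]eq_sym.
by rewrite !andbA [in_triangle_componentb x && _]andbC.
Qed.

Let splitsE c : splits component_nonadj c triangle_vertices triangle_vertices =
  (#|pair_sets (split_rel c)|).*2.
Proof.
rewrite -card_pair_sets //; last first.
  by move=> x; rewrite /split_rel /component_nonadj eqxx !andbF.
rewrite /splits /triangle_vertices big_filter big_enum_cond /= big_mkcond.
apply: eq_bigr => x _; rewrite /split_rel.
case: in_triangle_componentb => /=; last by rewrite big1.
rewrite big_filter big_enum_cond /= big_mkcond.
by apply: eq_bigr => y _; case: in_triangle_componentb.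
Qed.

Let tri_connect x y : connect e x y ->
  in_triangle_componentb x = in_triangle_componentb y.
Proof.
move=> cxy; apply: eq_existsb => a; rewrite (same_connect conn_sym cxy) //.
Qed.

(** From a completion, the classes of non-adjacency inside the triangle components of [G] form a
    clustering, and every split pair must be an added edge. Conversely, add the split pairs. In a
    paw inside a triangle component, the pendant vertex [w] would share the colours of [y] and [z],
    which are then non-adjacent; in any other component nothing is added, so the triangle would
    already be in [G]. *)
Lemma yes_instance_cluster_deletion k :
  yes_instance (G, k) <-> cluster_deletion component_nonadj triangle_vertices k.
Proof.
split.
  case=> F [/= Fsub Fk /paw_freeP pf].
  set e' : rel G := @sedge (add_edges F) in pf.
  have se' : symmetric e' := @sedge_sym (add_edges F).
  have ie' : irreflexive e' := @sedge_irrefl (add_edges F).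
  have ee' x y : e x y -> e' x y by rewrite /e' /= /add_edges_rel /e => ->.
  have cc' x y : connect e x y -> connect e' x y.
    by move=> cxy; apply: connect_sub cxy => u v /ee'; apply: connect1.
  have tri' x : in_triangle_componentb x -> in_triangle_component e' x.
    case/in_triangle_componentP=> a /cc' xa [b [c [ab ac bc]]].
    by exists a => //; exists b, c; split; apply: ee'.
  (* Connectivity is taken in [G], so that added edges between components are ignored. *)
  pose same x y := connect e x y && ~~ e' x y.
  (* The position of the first vertex of a class is a canonical colour for the class. *)
  pose c x := find (same x) (enum G).
  have sameE x y : in_triangle_componentb x -> same x y -> c x = c y.
    move=> tx /andP[xy nxy]; apply: eq_find => z; rewrite /same.
    rewrite (same_connect conn_sym xy); case yz : connect => //=.
    apply/idP/idP.
      apply: (nonadj_trans se' pf (y := x)); rewrite ?[e' y x]se' //.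
        by apply: tri'; rewrite -(tri_connect xy).
      by apply: cc'; rewrite conn_sym.
    by apply: (nonadj_trans se' pf (y := y)); rewrite ?cc' //; apply: tri'.
  have hasc x : has (same x) (enum G).
    by apply/hasP; exists x; rewrite ?mem_enum // /same connect0 ie'.
  have cE x y : in_triangle_componentb x -> c x = c y -> same x y.
    move=> tx E; have := nth_find x (hasc x); have := nth_find x (hasc y).
    rewrite -/(c x) -/(c y) -E; set z := nth _ _ _.
    move=> /andP[yz nyz] /andP[xz nxz]; rewrite /same.
    rewrite (connect_trans xz) /=; last by rewrite conn_sym.
    apply: (nonadj_trans se' pf (y := z)); rewrite ?[e' z y]se' //.
      exact: tri'.
    exact: cc'.
  exists c => [x y|].
    rewrite !mem_filter => /andP[tx _] /andP[ty _] /(cE _ _ tx) /andP[xy nxy].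
    rewrite /component_nonadj xy eq_sym; case: eqP => //= _; rewrite andbT.
    by apply: contra nxy; apply: ee'.
  rewrite splitsE leq_double; apply: leq_trans Fk.
  apply/subset_leq_card/subsetP => A /imsetP[[x y]]; rewrite inE /=.
  move=> /and4P[tx ty /and3P[xy nxy neq] nc] ->.
  have : e' x y.
    by apply: contraNT nc => ne'; apply/eqP/sameE; rewrite // /same xy.
  by rewrite /e' /= /add_edges_rel -/(e x y) (negbTE nxy) => /andP[].
case=> c cS cost; exists (pair_sets (split_rel c)); split=> /=.
- apply/subsetP => A /imsetP[[x y]].
  rewrite inE /= => /and4P[_ _ /and3P[_ nxy neq] _] ->.
  by apply/imsetP; exists (x, y); rewrite ?inE /= ?neq.
- by rewrite -leq_double -splitsE.
apply/paw_freeP.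
set e' : rel G := @sedge (add_edges _).
have e'E u v : e' u v = e u v || (u != v) && split_rel c u v.
  by rewrite /e' /= /add_edges_rel mem_pair_sets.
have e'c u v : e' u v -> connect e u v.
  rewrite e'E => /orP[/connect1 //|/andP[_ /and4P[_ _ /and3P[]]]] //.
move=> x y z w xy xz yz xw wy wz.
apply/negPn/negP; rewrite negb_or => /andP[nwy nwz].
have cxy := e'c _ _ xy; have cxz := e'c _ _ xz; have cxw := e'c _ _ xw.
case tx : (in_triangle_componentb x).
  have same u v :
      connect e x u -> connect e x v -> u != v -> ~~ e' u v -> c u = c v.
    move=> xu xv uv; rewrite e'E negb_or => /andP[nuv].
    rewrite uv /split_rel -(tri_connect xu) -(tri_connect xv) tx /=.
    rewrite /component_nonadj uv nuv negb_and negbK /= andbT.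
    rewrite -(same_connect conn_sym xu) xv /= => /eqP //.
  have cyz : c y = c z by rewrite -(same w y) // -(same w z).
  have memS u : connect e x u -> u \in triangle_vertices.
    by move=> xu; rewrite mem_filter mem_enum -(tri_connect xu) tx.
  have := cS y z (memS y cxy) (memS z cxz) cyz.
  have nyz : z != y.
    by apply: contraTneq yz => ->; rewrite e'E /e sedge_irrefl eqxx.
  rewrite (negbTE nyz) /= => /and3P[_ neyz _]; move: yz.
  by rewrite e'E (negbTE neyz) /split_rel cyz eqxx !andbF.
have plain u v : connect e x u -> e' u v -> e u v.
  move=> xu; rewrite e'E => /orP[//|/andP[_]].
  by rewrite /split_rel -(tri_connect xu) tx.
case/negP: (negbT tx); apply/in_triangle_componentP; exists x => //.
by exists y, z; split; apply: plain.
Qed.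

End Reduction.

(** * Polynomial time on encoded types *)

(* Numbers are unary inside programs; only the parameter of an instance is read
   and written in binary. *)
Class encodable (A : Type) := enc : A -> tree.
#[export] Hint Mode encodable ! : typeclass_instances.

#[export] Instance encodable_bool : encodable bool := enc_bool.
#[export] Instance encodable_unit : encodable unit := fun=> Leaf.
#[export] Instance encodable_nat : encodable nat :=
  fun n => iter n (Node Leaf) Leaf.
#[export] Instance encodable_prod A B (eA : encodable A) (eB : encodable B) :
  encodable (A * B) := fun p => Node (enc p.1) (enc p.2).
#[export] Instance encodable_seq A (eA : encodable A) : encodable (seq A) :=
  enc_seq enc.

Definition esize {A : Type} {eA : encodable A} (x : A) : nat := tsize (enc x).

Lemma tsize_gt0 t : 0 < tsize t. Proof. by case: t. Qed.

Lemma esize_gt0 A (eA : encodable A) (x : A) : 0 < esize x.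
Proof. exact: tsize_gt0. Qed.

Lemma leq_exp1 m n d : m <= n -> m ^ d <= n ^ d.
Proof. by case: d => // d ?; rewrite leq_exp2r. Qed.

(** * Polynomial bounds *)

Section PolyBound.
Context {A : Type} {eA : encodable A}.
Implicit Types g h : A -> nat.

(** The base is at least 2 because encodings are nonempty, so constant factors and summands are
    absorbed by the exponent. *)
Definition pbound g := exists d, forall x, g x <= (esize x).+1 ^ d.

Lemma pbound_le g h : (forall x, g x <= h x) -> pbound h -> pbound g.
Proof. by move=> le_gh [d Hd]; exists d => x; apply: leq_trans (Hd x). Qed.

Lemma pbound_add g h : pbound g -> pbound h -> pbound (fun x => g x + h x).
Proof.
move=> [a Ha] [b Hb]; exists (a + b).+1 => x.
have N2 : 1 < (esize x).+1 by rewrite ltnS esize_gt0.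
apply: (@leq_trans (2 * (esize x).+1 ^ (a + b))).
  rewrite mul2n -addnn leq_add //.
    by apply: leq_trans (Ha x) _; rewrite leq_exp2l // leq_addr.
  by apply: leq_trans (Hb x) _; rewrite leq_exp2l // leq_addl.
by rewrite expnS leq_mul2r N2 orbT.
Qed.

Lemma pbound_mul g h : pbound g -> pbound h -> pbound (fun x => g x * h x).
Proof. by move=> [a Ha] [b Hb]; exists (a + b) => x; rewrite expnD leq_mul. Qed.

Lemma pbound_const n : pbound (fun=> n).
Proof.
exists n => x; apply: leq_trans (ltnW (ltn_expl n (ltnSn 1))) _.
by apply: leq_exp1; rewrite ltnS esize_gt0.
Qed.

Lemma pbound_esize : pbound esize.
Proof. by exists 1 => x; rewrite expn1. Qed.

End PolyBound.

Lemma pbound_comp A B (eA : encodable A) (eB : encodable B)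
    (f : A -> B) (g : B -> nat) :
  pbound g -> pbound (fun x => esize (f x)) -> pbound (fun x => g (f x)).
Proof.
move=> [a Ha] /(fun H => pbound_add H (pbound_const 1)) [b Hb].
exists (b * a) => x; apply: leq_trans (Ha _) _; rewrite expnM; apply: leq_exp1.
by rewrite -addn1.
Qed.

(* The other registers may hold anything at the start, and those from [m] on
   survive, so that a compound command can keep its own data there. *)
Definition pt {A B} {eA : encodable A} {eB : encodable B} (f : A -> B) :=
  exists (c : cmd) (m : nat) (g : A -> nat), pbound g /\
    forall (x : A) (s : store), s 0 = enc x ->
      exists t s', [/\ exec c s t s', s' 0 = enc (f x),
                       forall y, m <= y -> s' y = s y & t <= g x].

Lemma tsize_eval s e : tsize (eval s e) <= ecost s e.
Proof. by case: e => *; apply: leq_addr. Qed.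

(** An assignment is charged the size of the value it stores. Hence polynomial time implies outputs
    of polynomial size, which is what makes [pt] compose. *)
Lemma exec_tsize c s t s' :
  exec c s t s' -> forall x, s' x = s x \/ tsize (s' x) <= t.
Proof.
elim=> {c s t s'} [|s x e y|c1 c2 s s1 s2 t1 t2 _ IH1 _ IH2 x
  |e c1 c2 s s1 t _ _ IH x|e c1 c2 s s1 t _ _ IH x||
  e c s s1 s2 t1 t2 _ _ IH1 _ IH2 x]; try by left.
- by rewrite /upd; case: eqP => _; [right; apply: tsize_eval|left].
- case: (IH2 x) => [->|]; last by right; lia.
  by case: (IH1 x) => [->|]; [left|right; lia].
- by case: (IH x) => [->|]; [left|right; lia].
- by case: (IH x) => [->|]; [left|right; lia].
- case: (IH2 x) => [->|]; last by right; lia.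
  by case: (IH1 x) => [->|]; [left|right; lia].
Qed.

Lemma pt_esize A B (eA : encodable A) (eB : encodable B) (f : A -> B) :
  pt f -> pbound (fun x => esize (f x)).
Proof.
move=> [c] [m] [g] [pg Hc]; apply: pbound_le (pbound_add pbound_esize pg) => x.
have [t [s' [ex s'0 _ le_t]]] := Hc x (fun=> enc x) erefl.
case: (exec_tsize ex 0); rewrite s'0 /esize; first by move->; exact: leq_addr.
by move=> le; apply: leq_trans le (leq_trans le_t (leq_addl _ _)).
Qed.

Lemma pt_comp A B C (eA : encodable A) (eB : encodable B) (eC : encodable C)
    (f : A -> B) (g : B -> C) : pt g -> pt f -> pt (fun x => g (f x)).
Proof.
move=> [cg] [mg] [pg] [bg Hg] ptf; have szf := pt_esize ptf.
case: ptf => [cf] [mf] [pf] [bf Hf].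
exists (Seq cf cg), (maxn mf mg), (fun x => pf x + pg (f x)).
split; first by apply: pbound_add bf _; apply: pbound_comp.
move=> x s s0; have [t1 [s1 [ex1 s1E fr1 le1]]] := Hf x s s0.
have [t2 [s2 [ex2 s2E fr2 le2]]] := Hg _ _ s1E.
exists (t1 + t2), s2; split=> //.
- exact: ExecSeq ex1 ex2.
- by move=> y; rewrite geq_max => /andP[? ?]; rewrite fr2 // fr1.
- exact: leq_add.
Qed.

Lemma pt_id A (eA : encodable A) : pt (fun x : A => x).
Proof.
exists Skip, 0, (fun=> 1); split; first exact: pbound_const.
by move=> x s s0; exists 1, s; split=> //; apply: ExecSkip.
Qed.

(** Programs see only trees: a pair also serves as [a :: l], and a pair with [tt] as a successor. *)
Lemma pt_enc_eq A B C (eA : encodable A) (eB : encodable B) (eC : encodable C)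
    (f : A -> B) (g : A -> C) :
  (forall x, enc (f x) = enc (g x)) -> pt f -> pt g.
Proof.
move=> fg [c] [m] [p] [bp H]; exists c, m, p; split=> // x s s0.
have [t [s' [? s'E ? ?]]] := H x s s0.
by exists t, s'; split=> //; rewrite s'E fg.
Qed.

Lemma eq_pt A B (eA : encodable A) (eB : encodable B) (f g : A -> B) :
  f =1 g -> pt f -> pt g.
Proof. by move=> fg; apply: pt_enc_eq => x; rewrite fg. Qed.

Lemma upd_same s x v : upd s x v x = v. Proof. by rewrite /upd eqxx. Qed.

Lemma upd_other s x y v : y != x -> upd s x v y = s y.
Proof. by rewrite /upd => /negbTE->. Qed.

Lemma pt_expr A B (eA : encodable A) (eB : encodable B) (f : A -> B) e :
  (forall (x : A) s, s 0 = enc x -> eval s e = enc (f x)) ->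
  pbound (fun x : A => ecost (fun=> enc x) e) ->
  (forall s1 s2, s1 0 = s2 0 -> ecost s1 e = ecost s2 e) -> pt f.
Proof.
move=> ev bp ce; exists (Assign 0 e), 1, (fun x : A => ecost (fun=> enc x) e).
split=> // x s s0; exists (ecost s e), (upd s 0 (eval s e)); split.
- exact: ExecAssign.
- by rewrite upd_same; apply: ev.
- by move=> y y1; rewrite upd_other // -lt0n.
- by rewrite (ce s (fun=> enc x)).
Qed.

Fixpoint quote (t : tree) : expr :=
  if t is Node a b then Defs.Cons (quote a) (quote b) else Defs.Nil.

Lemma eval_quote s t : eval s (quote t) = t.
Proof. by elim: t => //= a -> b ->. Qed.

Lemma ecost_quote s1 s2 t : ecost s1 (quote t) = ecost s2 (quote t).
Proof. by elim: t => //= a IHa b IHb; rewrite IHa IHb !eval_quote. Qed.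

Lemma pt_const A B (eA : encodable A) (eB : encodable B) (b : B) :
  pt (fun _ : A => b).
Proof.
apply: (@pt_expr _ _ _ _ _ (quote (enc b))) => [x s _||s1 s2 _].
- exact: eval_quote.
- apply: pbound_le (pbound_const (ecost (fun=> Leaf) (quote (enc b)))) => x.
  by rewrite (ecost_quote _ (fun=> Leaf)).
- exact: ecost_quote.
Qed.

Lemma pt_hd A B (eA : encodable A) (eB : encodable B) (f : A -> B) :
  (forall x : A, enc (f x) = if enc x is Node u _ then u else Leaf) -> pt f.
Proof.
move=> fE.
apply: (@pt_expr _ _ _ _ _ (Hd (Var 0))) => [x s /= ->||s1 s2 /= ->] //.
apply: (@pbound_le _ _ _ (fun x : A => esize x + esize x)) => [x /=|].
  by rewrite addn0 leq_add2r /esize; case: (enc x) => //= u v; lia.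
by apply: pbound_add; apply: pbound_esize.
Qed.

Lemma pt_tl A B (eA : encodable A) (eB : encodable B) (f : A -> B) :
  (forall x : A, enc (f x) = if enc x is Node _ u then u else Leaf) -> pt f.
Proof.
move=> fE.
apply: (@pt_expr _ _ _ _ _ (Tl (Var 0))) => [x s /= ->||s1 s2 /= ->] //.
apply: (@pbound_le _ _ _ (fun x : A => esize x + esize x)) => [x /=|].
  by rewrite addn0 leq_add2r /esize; case: (enc x) => //= u v; lia.
by apply: pbound_add; apply: pbound_esize.
Qed.

Lemma exec_assign_seq c x e s t s' :
  exec c (upd s x (eval s e)) t s' ->
  exec (Seq (Assign x e) c) s (ecost s e + t) s'.
Proof. exact/ExecSeq/ExecAssign. Qed.

(** The input is saved in register [M] and the value of [f] in [M.+1], both beyond the registers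
    that the two subprograms may change. *)
Lemma pt_pair A B C (eA : encodable A) (eB : encodable B) (eC : encodable C)
    (f : A -> B) (g : A -> C) : pt f -> pt g -> pt (fun x => (f x, g x)).
Proof.
move=> ptf ptg; have szf := pt_esize ptf; have szg := pt_esize ptg.
case: ptf => [cf] [mf] [pf] [bf Hf]; case: ptg => [cg] [mg] [pg] [bg Hg].
set M := (maxn mf mg).+1.
exists (Seq (Assign M (Var 0)) (Seq cf (Seq (Assign M.+1 (Var 0))
  (Seq (Assign 0 (Var M)) (Seq cg
    (Assign 0 (Defs.Cons (Var M.+1) (Var 0)))))))), M.+2.
exists (fun x : A => esize x + (pf x + (esize (f x) + (esize x + (pg x +
  ((esize (f x) + esize (g x)).+1 + (esize (f x) + esize (g x)))))))).
split.
  have bx := @pbound_esize _ eA; have bfg := pbound_add szf szg.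
  repeat (apply: pbound_add => //).
  apply: pbound_le (pbound_add (pbound_const 1) bfg) => x; lia.
move=> x s s0.
have [t1 [s1 [ex1 s1E fr1 le1]]] := Hf x (upd s M (s 0)) s0.
have [t2 [s2 [ex2 s2E fr2 le2]]] :=
  Hg x (upd (upd s1 M.+1 (s1 0)) 0 (upd s M (s 0) M))
    (etrans (upd_same s M _) s0).
have [Mf Mg] : mf <= M /\ mg <= M by rewrite /M; lia.
have s1M : s1 M = enc x by rewrite fr1 ?upd_same.
have s2M : s2 M.+1 = enc (f x).
  rewrite fr2; last lia.
  by rewrite upd_other // upd_same.
eexists; eexists; split.
- apply: exec_assign_seq; apply: ExecSeq ex1 _; apply: exec_assign_seq.
  apply: exec_assign_seq; apply: ExecSeq; last exact: ExecAssign.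
  have -> : eval (upd s1 M.+1 (eval s1 (Var 0))) (Var M) = upd s M (s 0) M.
    by rewrite /= upd_other ?neq_ltn ?ltnS ?leqnn // s1M upd_same.
  exact: ex2.
- by rewrite upd_same /= s2M s2E.
- move=> y yM; rewrite upd_other; last lia.
  rewrite fr2; last lia.
  rewrite !upd_other; [|lia..].
  rewrite fr1; last lia.
  by rewrite upd_other //; lia.
- rewrite /= !addn0 s2M s2E s1E s0 upd_other; last lia.
  by rewrite s1M /esize; lia.
Qed.

Definition truthy (t : tree) : bool := if t is Node _ _ then true else false.

Lemma truthy_neq t : truthy t -> t <> Leaf. Proof. by case: t. Qed.
Lemma truthy_eq t : ~~ truthy t -> t = Leaf. Proof. by case: t. Qed.

(** Any encoded value can act as the condition, so a list or a number is tested for being empty or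
    zero directly. *)
Lemma pt_test A B C (eA : encodable A) (eB : encodable B) (eC : encodable C)
    (b : A -> bool) (q : A -> C) (f g : A -> B) :
  (forall x, b x = truthy (enc (q x))) ->
  pt q -> pt f -> pt g -> pt (fun x => if b x then f x else g x).
Proof.
move=> bE ptq; have szq := pt_esize ptq; case: ptq => [cq] [mq] [pq] [bq Hq].
move=> [cf] [mf] [pf] [bf Hf] [cg] [mg] [pg] [bg Hg].
set M := (maxn mq (maxn mf mg)).+1.
exists (Seq (Assign M (Var 0)) (Seq cq (If (Var 0)
   (Seq (Assign 0 (Var M)) cf) (Seq (Assign 0 (Var M)) cg)))), M.+1.
exists (fun x : A =>
  esize x + (pq x + (esize (q x) + (esize x + (pf x + pg x))))).
split; first by have bx := @pbound_esize _ eA; repeat (apply: pbound_add => //).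
move=> x s s0.
have [t1 [s1 [ex1 s1E fr1 le1]]] := Hq x (upd s M (s 0)) s0.
have [Mq [Mf Mg]] : mq <= M /\ mf <= M /\ mg <= M by rewrite /M; lia.
have s1M : s1 M = enc x by rewrite fr1 ?upd_same.
have [t2 [s2 [ex2 s2E fr2 le2]]] := Hf x (upd s1 0 (s1 M)) s1M.
have [t3 [s3 [ex3 s3E fr3 le3]]] := Hg x (upd s1 0 (s1 M)) s1M.
case: ifP => bx.
- eexists; eexists; split.
  + apply: exec_assign_seq; apply: ExecSeq ex1 _; apply: ExecIfTrue.
      by rewrite /= s1E; apply: truthy_neq; rewrite -bE.
    apply: exec_assign_seq; exact: ex2.
  + by [].
  + move=> y yM; rewrite fr2; last lia.
    rewrite upd_other; last lia.
    rewrite fr1; last lia.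
    by rewrite upd_other //; lia.
  + by rewrite /= !addn0 s1E s1M s0 /esize; lia.
- eexists; eexists; split.
  + apply: exec_assign_seq; apply: ExecSeq ex1 _; apply: ExecIfFalse.
      by rewrite /= s1E; apply: truthy_eq; rewrite -bE bx.
    apply: exec_assign_seq; exact: ex3.
  + by [].
  + move=> y yM; rewrite fr3; last lia.
    rewrite upd_other; last lia.
    rewrite fr1; last lia.
    by rewrite upd_other //; lia.
  + by rewrite /= !addn0 s1E s1M s0 /esize; lia.
Qed.

Lemma esize_pair A B (eA : encodable A) (eB : encodable B) (a : A) (b : B) :
  esize (a, b) = (esize a + esize b).+1.
Proof. by []. Qed.

Lemma esize_cons A (eA : encodable A) (a : A) l :
  esize (a :: l) = (esize a + esize l).+1.
Proof. by []. Qed.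

Lemma esize_seq A (eA : encodable A) (l : seq A) :
  esize l = (\sum_(a <- l) (esize a).+1).+1.
Proof.
elim: l => [|a l IH]; first by rewrite big_nil.
by rewrite esize_cons IH big_cons; lia.
Qed.

Lemma esize_nat (n : nat) : esize n = n.*2.+1.
Proof. by elim: n => // n IH; rewrite doubleS -IH. Qed.

Lemma esize_bool (b : bool) : esize b <= 3. Proof. by case: b. Qed.

Lemma size_esize A (eA : encodable A) (l : seq A) : size l < esize l.
Proof. by rewrite esize_seq ltnS -sum1_size leq_sum. Qed.

Lemma esize_cat A (eA : encodable A) (l1 l2 : seq A) :
  (esize (l1 ++ l2)).+1 = esize l1 + esize l2.
Proof. by rewrite !esize_seq big_cat /=; lia. Qed.

Lemma esize_take A (eA : encodable A) (l : seq A) i :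
  esize (take i l) <= esize l.
Proof.
rewrite -{2}(cat_take_drop i l) -ltnS esize_cat -addn1 leq_add2l.
exact: esize_gt0.
Qed.

Lemma esize_rev A (eA : encodable A) (l : seq A) : esize (rev l) = esize l.
Proof.
elim: l => // a l IH; rewrite rev_cons -cats1; apply: succn_inj.
by rewrite esize_cat IH !esize_cons; have -> : esize (@nil A) = 1 by []; lia.
Qed.

Lemma esize_filter A (eA : encodable A) (P : pred A) (l : seq A) :
  esize (filter P l) <= esize l.
Proof.
by rewrite !esize_seq big_filter ltnS [X in _ <= X](bigID P) leq_addr.
Qed.

Lemma esize_map A B (eA : encodable A) (eB : encodable B) (f : A -> B) l m :
  (forall a, esize a <= esize l -> esize (f a) <= m) ->
  esize (map f l) <= (size l * m.+1).+1.
Proof.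
move=> H; elim: l H => [|a l IH] H; first by [].
rewrite [map _ _]/= esize_cons -[size (a :: l)]/(size l).+1 mulSn.
have := H a; have : esize (map f l) <= (size l * m.+1).+1.
  by apply: IH => b le; apply: H; rewrite esize_cons; lia.
rewrite esize_cons => le1 le2; have {}le2 : esize (f a) <= m by apply: le2; lia.
lia.
Qed.

(** * Programs for basic operations and loops *)

Section Combinators.
Context {C : Type} {eC : encodable C}.

Lemma pt_fst A B (eA : encodable A) (eB : encodable B) (f : C -> A * B) :
  pt f -> pt (fun x => (f x).1).
Proof. by apply: pt_comp; apply: pt_hd. Qed.

Lemma pt_snd A B (eA : encodable A) (eB : encodable B) (f : C -> A * B) :
  pt f -> pt (fun x => (f x).2).
Proof. by apply: pt_comp; apply: pt_tl. Qed.

Lemma pt_cons A (eA : encodable A) (a : C -> A) (l : C -> seq A) :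
  pt a -> pt l -> pt (fun x => a x :: l x).
Proof. by move=> pa pl; apply: (pt_enc_eq _ (pt_pair pa pl)). Qed.

Lemma pt_behead A (eA : encodable A) (l : C -> seq A) :
  pt l -> pt (fun x => behead (l x)).
Proof. by apply: pt_comp; apply: pt_tl => -[|a l']. Qed.

(** [Hd] of [Leaf] is [Leaf], so the default value has to be encoded by [Leaf]. *)
Lemma pt_head A (eA : encodable A) (l : C -> seq A) a0 : enc a0 = Leaf ->
  pt l -> pt (fun x => head a0 (l x)).
Proof. by move=> a0E; apply: pt_comp; apply: pt_hd => -[|a l']. Qed.

Lemma pt_succ (n : C -> nat) : pt n -> pt (fun x => (n x).+1).
Proof.
by move=> pn; apply: (pt_enc_eq _ (pt_pair (@pt_const C unit eC _ tt) pn)).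
Qed.

Lemma pt_pred (n : C -> nat) : pt n -> pt (fun x => (n x).-1).
Proof. by apply: pt_comp; apply: pt_tl => -[|n']. Qed.

Lemma pt_if A (eA : encodable A) (b : C -> bool) (f g : C -> A) :
  pt b -> pt f -> pt g -> pt (fun x => if b x then f x else g x).
Proof. by apply: pt_test => x; case: (b x). Qed.

Lemma pt_and (b c : C -> bool) : pt b -> pt c -> pt (fun x => b x && c x).
Proof. by move=> pb pc; apply: pt_if => //; apply: pt_const. Qed.

Lemma pt_or (b c : C -> bool) : pt b -> pt c -> pt (fun x => b x || c x).
Proof. by move=> pb pc; apply: pt_if => //; apply: pt_const. Qed.

Lemma pt_not (b : C -> bool) : pt b -> pt (fun x => ~~ b x).
Proof. by move=> pb; apply: pt_if => //; apply: pt_const. Qed.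

Lemma pt_implb (b c : C -> bool) : pt b -> pt c -> pt (fun x => b x ==> c x).
Proof. by move=> pb pc; apply: pt_if => //; apply: pt_const. Qed.

Lemma pt_nilp A (eA : encodable A) (l : C -> seq A) :
  pt l -> pt (fun x => nilp (l x)).
Proof.
move=> pl; apply: (@eq_pt _ _ _ _
  (fun x => if ~~ nilp (l x) then false else true)).
  by move=> x; case: (l x).
by apply: (pt_test _ pl) => [x||]; [case: (l x)|apply: pt_const..].
Qed.

Lemma pt_eq0 (n : C -> nat) : pt n -> pt (fun x => n x == 0).
Proof.
move=> pn; apply: (@eq_pt _ _ _ _ (fun x => if n x != 0 then false else true)).
  by move=> x; case: (n x).
by apply: (pt_test _ pn) => [x||]; [case: (n x)|apply: pt_const..].
Qed.

End Combinators.

Section Fold.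
Context {C A B : Type} {eC : encodable C} {eA : encodable A} {eB : encodable B}.
Variables (l : C -> seq A) (z : C -> B) (step : C -> B -> A -> B).

(* The bound on intermediate values is what keeps the iteration of a
   polynomial-time step polynomial. *)
Lemma pt_foldl :
  pt l -> pt z -> pt (fun p : C * A * B => step p.1.1 p.2 p.1.2) ->
  (exists2 g, pbound g &
     forall x i, esize (foldl (step x) (z x) (take i (l x))) <= g x) ->
  pt (fun x => foldl (step x) (z x) (l x)).
Proof.
move=> pl pz [c] [m] [p] [bp Hstep] [g bg bound].
have sl := pt_esize pl.
have := pt_pair (pt_id eC) (pt_pair pl pz).
move=> [c0] [m0] [p0] [bp0 H0].
case: bp => d le_pd.
(* Register [M] keeps [x], [M1] the rest of the list, and 0 the accumulator. *)
pose M := (maxn m m0).+1; pose M1 := M.+1.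
pose arg := Defs.Cons (Defs.Cons (Var M) (Hd (Var M1))) (Var 0).
pose body := Seq (Assign 0 arg) (Seq (Assign M1 (Tl (Var M1))) c).
(* [sz] bounds the data of one pass and [it] its time: the loop test and the two assignments cost at
   most [9 * sz x], the step itself at most the power. *)
pose (sz := fun x : C => esize x + esize (l x) + g x + 3).
pose (it := fun x : C => 14 * sz x + (sz x).+1 ^ d).
have bsz : pbound sz.
  by do ![apply: pbound_add => //]; [apply: pbound_esize|apply: pbound_const].
have bit : pbound it.
  apply: pbound_add; first by apply: pbound_mul => //; apply: pbound_const.
  case: (pbound_add bsz (pbound_const 1)) => e He; exists (e * d) => x.
  by rewrite expnM; apply: leq_exp1; rewrite -addn1.
have loop x : forall l1 l2 s, l x = l1 ++ l2 -> s M = enc x -> s M1 = enc l2 ->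
  s 0 = enc (foldl (step x) (z x) l1) ->
  exists t s', [/\ exec (While (Var M1) body) s t s',
    s' 0 = enc (foldl (step x) (z x) (l x)), forall y, M1 < y -> s' y = s y
    & t <= (size l2).+1 * it x].
  move=> l1 l2; elim: l2 l1 => [|a l2 IH] l1 s lE sM sM1 s0.
    exists (ecost s (Var M1)), s; split=> //.
    - by apply: ExecWhileFalse; rewrite /= sM1.
    - by rewrite s0 lE cats0.
    - by rewrite /= sM1 (_ : tsize _ = 1) // /it /sz; lia.
  set b := foldl _ _ l1 in s0.
  pose (s1 := upd s 0 (enc ((x, a), b))).
  pose (s2 := upd s1 M1 (enc l2)).
  have [t [s3 [ex3 s3E fr3 le3]]] := Hstep ((x, a), b) s2 erefl.
  have mM : m <= M by rewrite /M; lia.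
  have [||||t' [s4 [ex4 s4E fr4 le4]]] := IH (rcons l1 a) s3.
  - by rewrite cat_rcons.
  - rewrite fr3 // /s2 upd_other; last by rewrite /M1; lia.
    by rewrite /s1 upd_other.
  - by rewrite fr3 /s2 ?upd_same //; rewrite /M1; lia.
  - by rewrite s3E foldl_rcons.
  have al : esize (a :: l2) <= esize (l x).
    by rewrite lE -ltnS esize_cat -add1n leq_add2r esize_gt0.
  have bl : esize b <= g x.
    by have := bound x (size l1); rewrite lE take_size_cat.
  have tl : t <= (sz x).+1 ^ d.
    apply: leq_trans le3 (leq_trans (le_pd _) (leq_exp1 _ _)).
    by move: al; rewrite /sz !esize_pair esize_cons; lia.
  have eE : eval s arg = enc ((x, a), b) by rewrite /= sM sM1 s0.
  have tE : eval s1 (Tl (Var M1)) = enc l2 by rewrite /= /s1 upd_other // sM1.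
  eexists; exists s4; split.
  - apply: ExecWhileTrue ex4; first by rewrite /= sM1.
    apply: exec_assign_seq; rewrite eE -/s1.
    by apply: exec_assign_seq; rewrite tE; exact: ex3.
  - exact: s4E.
  - move=> y yM; rewrite fr4 // fr3; last by move: yM; rewrite /M1; lia.
    rewrite /s2 upd_other; last by rewrite neq_ltn yM orbT.
    by rewrite /s1 upd_other // -lt0n; lia.
  - have c1 : ecost s (Var M1) <= sz x.
      by rewrite /= addn0 sM1 -/(esize _) /sz; lia.
    have c2 : ecost s arg <= 6 * sz x.
      rewrite /= sM sM1 s0 /= -[encodable_seq _ _]/(enc l2).
      move: al bl; rewrite esize_cons /sz /esize; lia.
    have c3 : ecost s1 (Tl (Var M1)) <= 2 * sz x.
      rewrite /= /s1 upd_other // sM1 /= -[encodable_seq _ _]/(enc l2).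
      move: al bl; rewrite esize_cons /sz /esize; lia.
    have itE : it x = 14 * sz x + (sz x).+1 ^ d by [].
    rewrite -[size (a :: l2)]/(size l2).+1 mulSn; move: le4.
    by move: (_.+1 * it x) => w; lia.
exists (Seq c0 (Seq (Assign M (Hd (Var 0))) (Seq (Assign M1 (Hd (Tl (Var 0))))
  (Seq (Assign 0 (Tl (Tl (Var 0)))) (While (Var M1) body))))), M1.+1.
exists (fun x => p0 x + (9 * sz x + 9 + esize (l x) * it x)); split.
  apply: pbound_add => //; apply: pbound_add; last exact: pbound_mul.
  by apply: pbound_add; [apply: pbound_mul|]; do ?apply: pbound_const.
move=> x s s0; have [t [s1 [ex1 s1E fr1 le1]]] := H0 x s s0.
pose (s2 := upd (upd (upd s1 M (enc x)) M1 (enc (l x))) 0 (enc (z x))).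
have [||||t' [s3 [ex3 s3E fr3 le3]]] := loop x [::] (l x) s2.
- by [].
- rewrite /s2 upd_other // upd_other; last by rewrite /M1; lia.
  exact: upd_same.
- by rewrite /s2 upd_other // upd_same.
- exact: upd_same.
have bz : esize (z x) <= g x by have := bound x 0; rewrite take0.
eexists; exists s3; split.
- apply: ExecSeq ex1 _; apply: exec_assign_seq; rewrite /= s1E /=.
  apply: exec_assign_seq; rewrite /= upd_other // s1E /=.
  apply: exec_assign_seq; rewrite /= upd_other // upd_other // s1E /=.
  exact: ex3.
- exact: s3E.
- move=> y yM; rewrite fr3 // /s2 upd_other; last by rewrite -lt0n; lia.
  rewrite upd_other; last by rewrite neq_ltn yM orbT.
  rewrite upd_other; last by move: yM; rewrite /M1; lia.
  by rewrite fr1 //; move: yM; rewrite /M1 /M; lia.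
- have t'le : t' <= esize (l x) * it x.
    by apply: leq_trans le3 _; rewrite leq_mul2r size_esize orbT.
  rewrite /= !upd_other // s1E /= -/(esize x) -/(esize (l x)) -/(esize (z x)).
  by move: le1 t'le; rewrite /sz; lia.
Qed.

End Fold.

Ltac pt_basic_step := cbv beta; lazymatch goal with
  | |- @pt _ _ _ _ (fun x => x) => exact: pt_id
  | |- @pt _ _ _ _ (fun _ => ?b) => exact: pt_const
  | |- @pt _ _ _ _ (@fst _ _) => exact: (pt_fst (pt_id _))
  | |- @pt _ _ _ _ (@snd _ _) => exact: (pt_snd (pt_id _))
  | |- @pt _ _ _ _ (fun x => @fst _ _ _) => apply: pt_fst
  | |- @pt _ _ _ _ (fun x => @snd _ _ _) => apply: pt_snd
  | |- @pt _ _ _ _ (fun x => @pair _ _ _ _) => apply: pt_pair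
  | |- @pt _ _ _ _ (fun x => @cons _ _ _) => apply: pt_cons
  | |- @pt _ _ _ _ (fun x => @behead _ _) => apply: pt_behead
  | |- @pt _ _ _ _ (fun x => @nilp _ _) => apply: pt_nilp
  | |- @pt _ _ _ _ (fun x => @head _ _ _) => apply: pt_head; first by []
  | |- @pt _ _ _ _ (fun x => S _) => apply: pt_succ
  | |- @pt _ _ _ _ (fun x => predn _) => apply: pt_pred
  | |- @pt _ _ _ _ (fun x => @eq_op _ _ 0) => apply: pt_eq0
  | |- @pt _ _ _ _ (fun x => andb _ _) => apply: pt_and
  | |- @pt _ _ _ _ (fun x => orb _ _) => apply: pt_or
  | |- @pt _ _ _ _ (fun x => negb _) => apply: pt_not
  | |- @pt _ _ _ _ (fun x => implb _ _) => apply: pt_implb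
  | |- @pt _ _ _ _ (fun x => if _ then _ else _) => apply: pt_if
  end.

Ltac pt_basic := repeat first [assumption | pt_basic_step].

Lemma foldl_consE A B (f : A -> B) l z :
  foldl (fun acc a => f a :: acc) z l = catrev (map f l) z.
Proof. by elim: l z => //= a l IH z; rewrite IH. Qed.

Lemma foldl_filterE A (P : pred A) l z :
  foldl (fun acc a => if P a then a :: acc else acc) z l =
  catrev (filter P l) z.
Proof. by elim: l z => //= a l IH z; rewrite IH; case: (P a). Qed.

Lemma foldl_addnE l z : foldl addn z l = z + sumn l.
Proof. by elim: l z => //= [|a l IH] z; rewrite ?addn0 // IH addnA. Qed.

Lemma foldl_countE A (P : pred A) l z :
  foldl (fun n a => if P a then n.+1 else n) z l = z + count P l.
Proof.
elim: l z => //= [|a l IH] z; rewrite ?addn0 // IH.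
by case: (P a); rewrite ?addnS.
Qed.

Lemma foldl_hasE A (P : pred A) l z :
  foldl (fun b a => b || P a) z l = z || has P l.
Proof. by elim: l z => //= [|a l IH] z; rewrite ?orbF // IH orbA. Qed.

Lemma foldl_nseqE B (f : B -> B) n z :
  foldl (fun b (_ : unit) => f b) z (nseq n tt) = iter n f z.
Proof. by elim: n z => //= n IH z; rewrite IH -iterSr. Qed.

(** Pushing the current length in each round lists the numbers downwards; this is how programs
    obtain [iota]. *)
Lemma foldl_iotaE A (l : seq A) z :
  rev (foldl (fun acc _ => size acc :: acc) z l) =
  rev z ++ iota (size z) (size l).
Proof.
by elim: l z => [|a l IH] z; rewrite ?cats0 //= IH rev_cons cat_rcons.
Qed.

Lemma nth_iter_behead A (a0 : A) l i : nth a0 l i = head a0 (iter i behead l).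
Proof.
elim: i l => [|i IH] l; first exact: nth0.
by rewrite iterSr -IH nth_behead.
Qed.

Section Lists.
Context {C : Type} {eC : encodable C}.

Lemma pt_foldl_const A B (eA : encodable A) (eB : encodable B)
    (l : C -> seq A) (z : C -> B) (step : C -> B -> A -> B) n :
  pt l -> pt z -> pt (fun p : C * A * B => step p.1.1 p.2 p.1.2) ->
  (forall b : B, esize b <= n) ->
  pt (fun x => foldl (step x) (z x) (l x)).
Proof.
move=> pl pz ps le_n; apply: pt_foldl => //; exists (fun=> n) => //.
exact: pbound_const.
Qed.

Lemma pt_rev A (eA : encodable A) (l : C -> seq A) :
  pt l -> pt (fun x => rev (l x)).
Proof.
move=> pl; apply: (@eq_pt _ _ _ _
  (fun x => foldl (fun acc a => a :: acc) [::] (l x))) => [x|].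
  by rewrite (foldl_consE id) map_id.
apply: pt_foldl; try pt_basic.
exists (fun x => esize (l x)); first exact: pt_esize.
by move=> x i; rewrite (foldl_consE id) map_id -/(rev _) esize_rev esize_take.
Qed.

Lemma pt_map A B (eA : encodable A) (eB : encodable B)
    (l : C -> seq A) (f : C -> A -> B) :
  pt l -> pt (fun p : C * A => f p.1 p.2) ->
  pt (fun x => [seq f x a | a <- l x]).
Proof.
move=> pl pf; apply: (@eq_pt _ _ _ _
  (fun x => rev (foldl (fun acc a => f x a :: acc) [::] (l x)))) => [x|].
  by rewrite foldl_consE -/(rev _) revK.
have [d Hd] := pt_esize pf.
have sl := pt_esize pl.
apply: pt_rev; apply: pt_foldl => //; first by pt_basic.
- apply: pt_cons; last by pt_basic.
  by apply: (pt_comp (f := fst) (g := fun p : C * A => f p.1 p.2)); pt_basic.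
(* For [a] in [l x], the argument [(x, a)] of [f] has size polynomial in that of [x]; composing the
   two bounds gives the exponent [e * d]. *)
have [e He] := pbound_add pbound_esize (pbound_add sl (pbound_const 2)).
exists (fun x : C => (esize (l x) * ((esize x).+1 ^ (e * d)).+1).+1).
  have one := pbound_const 1.
  apply: (@pbound_le _ _ _ (fun x : C =>
    esize (l x) * ((esize x).+1 ^ (e * d) + 1) + 1)) => [x|].
    by rewrite !addn1.
  apply: pbound_add => //; apply: pbound_mul => //; apply: pbound_add => //.
  by exists (e * d).
move=> x i; rewrite foldl_consE -/(rev _) esize_rev.
apply: (leq_trans (@esize_map _ _ _ _ _ _ ((esize x).+1 ^ (e * d)) _)).
  move=> a le_a.
  apply: leq_trans (Hd (x, a)) _; rewrite expnM; apply: leq_exp1.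
  apply: leq_trans (He x); rewrite esize_pair.
  have := leq_trans le_a (esize_take _ _ _); lia.
rewrite ltnS leq_mul2r; apply/orP; right; apply: ltnW.
exact: leq_trans (size_esize eA _) (esize_take _ _ _).
Qed.

Lemma pt_filter A (eA : encodable A) (l : C -> seq A) (P : C -> pred A) :
  pt l -> pt (fun p : C * A => P p.1 p.2) ->
  pt (fun x => [seq a <- l x | P x a]).
Proof.
move=> pl pP; apply: (@eq_pt _ _ _ _ (fun x =>
  rev (foldl (fun acc a => if P x a then a :: acc else acc) [::] (l x)))).
  move=> x.
  by rewrite foldl_filterE -/(rev _) revK.
apply: pt_rev; apply: pt_foldl => //; first by pt_basic.
- apply: pt_if; try by pt_basic.
  by apply: (pt_comp (f := fst) (g := fun p : C * A => P p.1 p.2)); pt_basic.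
exists (fun x => esize (l x)); first exact: pt_esize.
move=> x i; rewrite foldl_filterE -/(rev _) esize_rev.
exact: leq_trans (esize_filter _ _ _) (esize_take _ _ _).
Qed.

Lemma pt_has A (eA : encodable A) (l : C -> seq A) (P : C -> pred A) :
  pt l -> pt (fun p : C * A => P p.1 p.2) -> pt (fun x => has (P x) (l x)).
Proof.
move=> pl pP; apply: (@eq_pt _ _ _ _ (fun x =>
  foldl (fun b a => b || P x a) false (l x))) => [x|].
  by rewrite foldl_hasE.
apply: (pt_foldl_const (n := 3)) => //; first by pt_basic.
- apply: pt_or; try by pt_basic.
  by apply: (pt_comp (f := fst) (g := fun p : C * A => P p.1 p.2)); pt_basic.
by case.
Qed.

Lemma pt_all A (eA : encodable A) (l : C -> seq A) (P : C -> pred A) :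
  pt l -> pt (fun p : C * A => P p.1 p.2) -> pt (fun x => all (P x) (l x)).
Proof.
move=> pl pP.
apply: (@eq_pt _ _ _ _ (fun x => ~~ has (fun a => ~~ P x a) (l x))).
  by move=> x; rewrite -all_predC; apply: eq_all => a /=; rewrite negbK.
by apply: pt_not; apply: pt_has => //; apply: pt_not.
Qed.

Lemma pt_count A (eA : encodable A) (l : C -> seq A) (P : C -> pred A) :
  pt l -> pt (fun p : C * A => P p.1 p.2) -> pt (fun x => count (P x) (l x)).
Proof.
move=> pl pP; apply: (@eq_pt _ _ _ _ (fun x =>
  foldl (fun n a => if P x a then n.+1 else n) 0 (l x))) => [x|].
  by rewrite foldl_countE.
apply: pt_foldl => //; first by pt_basic.
- apply: pt_if; try by pt_basic.
  by apply: (pt_comp (f := fst) (g := fun p : C * A => P p.1 p.2)); pt_basic.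
have sl := pt_esize pl.
exists (fun x => esize (l x) + esize (l x)); first exact: pbound_add.
move=> x i; rewrite foldl_countE esize_nat add0n.
have := count_size (P x) (take i (l x)).
have := leq_trans (size_esize eA (take i (l x))) (esize_take _ _ _); lia.
Qed.

Lemma pt_size A (eA : encodable A) (l : C -> seq A) :
  pt l -> pt (fun x => size (l x)).
Proof.
move=> pl; apply: (@eq_pt _ _ _ _ (fun x => count (fun=> true) (l x))) => [x|].
  exact: count_predT.
by apply: pt_count => //; apply: pt_const.
Qed.

(** A unary number has the same tree as a list of that many [tt], so the iteration runs as a
    fold. *)
Lemma pt_iter B (eB : encodable B)
    (n : C -> nat) (f : C -> B -> B) (z : C -> B) :
  pt n -> pt z -> pt (fun p : C * B => f p.1 p.2) ->
  (exists2 g, pbound g &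
     forall x i, i <= n x -> esize (iter i (f x) (z x)) <= g x) ->
  pt (fun x => iter (n x) (f x) (z x)).
Proof.
move=> pn pz pf [g bg Hg]; apply: (@eq_pt _ _ _ _ (fun x =>
  foldl (fun b (_ : unit) => f x b) (z x) (nseq (n x) tt))) => [x|].
  exact: foldl_nseqE.
apply: pt_foldl => //.
- apply: (pt_enc_eq _ pn) => x.
  by elim: (n x) => // m IH; exact: (congr1 (Node Leaf) IH).
- apply: (pt_comp (f := fun p : C * unit * B => (p.1.1, p.2))
    (g := fun p : C * B => f p.1 p.2)) => //; pt_basic.
exists g => // x i; case: (leqP i (n x)) => [le|/ltnW le].
  by rewrite take_nseq // foldl_nseqE; apply: Hg.
by rewrite take_oversize ?size_nseq // foldl_nseqE; apply: Hg.
Qed.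

Lemma pt_add (m n : C -> nat) : pt m -> pt n -> pt (fun x => m x + n x).
Proof.
move=> pm pn; apply: (@eq_pt _ _ _ _ (fun x => iter (m x) succn (n x))) => [x|].
  by rewrite iter_succn addnC.
apply: pt_iter => //; first by pt_basic.
exists (fun x => esize (m x) + esize (n x)).
  by apply: pbound_add; apply: pt_esize.
by move=> x i le_i; rewrite iter_succn !esize_nat; lia.
Qed.

Lemma pt_sub (m n : C -> nat) : pt m -> pt n -> pt (fun x => m x - n x).
Proof.
move=> pm pn; apply: (@eq_pt _ _ _ _ (fun x => iter (n x) predn (m x))) => [x|].
  by rewrite iter_predn.
apply: pt_iter => //; first by pt_basic.
exists (fun x => esize (m x)); first exact: pt_esize.
by move=> x i le_i; rewrite iter_predn !esize_nat; lia.
Qed.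

Lemma pt_leq (m n : C -> nat) : pt m -> pt n -> pt (fun x => m x <= n x).
Proof. by move=> pm pn; apply: pt_eq0; apply: pt_sub. Qed.

Lemma pt_eqn (m n : C -> nat) : pt m -> pt n -> pt (fun x => m x == n x).
Proof.
move=> pm pn; apply: (@eq_pt _ _ _ _ (fun x => (m x <= n x) && (n x <= m x))).
  by move=> x; rewrite eqn_leq.
by apply: pt_and; apply: pt_leq.
Qed.

Lemma pt_minn (m n : C -> nat) : pt m -> pt n -> pt (fun x => minn (m x) (n x)).
Proof.
by move=> pm pn; apply: pt_if => //; apply: pt_leq => //; apply: pt_succ.
Qed.

Lemma pt_double (n : C -> nat) : pt n -> pt (fun x => (n x).*2).
Proof.
move=> pn; apply: (@eq_pt _ _ _ _ (fun x => n x + n x)) => [x|].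
  exact: addnn.
exact: pt_add.
Qed.

Lemma pt_nth A (eA : encodable A) a0 (l : C -> seq A) (i : C -> nat) :
  enc a0 = Leaf -> pt l -> pt i -> pt (fun x => nth a0 (l x) (i x)).
Proof.
move=> a0E pl pi.
apply: (@eq_pt _ _ _ _ (fun x => head a0 (iter (i x) behead (l x)))).
  by move=> x; rewrite nth_iter_behead.
apply: pt_head => //; apply: pt_iter => //; first by pt_basic.
exists (fun x => esize (l x)); first exact: pt_esize.
move=> x j _; elim: j => // j IH; apply: leq_trans IH; rewrite iterS.
by case: (iter _ _ _) => // a l'; rewrite esize_cons /=; lia.
Qed.

End Lists.

Section Arithmetic.
Context {C : Type} {eC : encodable C}.

Lemma pt_iota A (eA : encodable A) (l : C -> seq A) :
  pt l -> pt (fun x => iota 0 (size (l x))).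
Proof.
move=> pl; apply: (@eq_pt _ _ _ _ (fun x =>
  rev (foldl (fun acc _ => size acc :: acc) [::] (l x)))) => [x|].
  by rewrite foldl_iotaE.
apply: pt_rev; apply: pt_foldl => //; first by pt_basic.
- by apply: pt_cons; [apply: pt_size|]; pt_basic.
have sl := pt_esize pl.
exists (fun x => esize (l x) * (esize (l x) + esize (l x) + 1) + 1).
  by do ![apply: pbound_add => //|apply: pbound_mul => //|exact: pbound_const].
move=> x i; rewrite -esize_rev foldl_iotaE /= addn1.
have := leq_trans (size_esize eA (take i (l x))) (esize_take _ _ _).
set L := esize (l x); set k := size _ => lt_kL.
have : all (fun j => j < L) (iota 0 k).
  by apply/allP => j; rewrite mem_iota /= add0n => /ltn_trans/(_ lt_kL).
rewrite -(size_iota 0 k) in lt_kL; move: (iota 0 k) lt_kL => s lt_sL alls.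
rewrite esize_seq ltnS; apply: (@leq_trans (size s * (L + L + 1))).
  elim: s {lt_sL} alls => [|j s IH] /=; first by rewrite big_nil.
  by case/andP=> jl /IH; rewrite big_cons esize_nat mulSn; lia.
by rewrite leq_mul2r ltnW ?orbT.
Qed.

Lemma pt_sumn (l : C -> seq nat) : pt l -> pt (fun x => sumn (l x)).
Proof.
move=> pl; apply: (@eq_pt _ _ _ _ (fun x => foldl addn 0 (l x))) => [x|].
  exact: foldl_addnE.
apply: pt_foldl => //; first by pt_basic.
- by apply: pt_add; pt_basic.
exists (fun x => esize (l x)); first exact: pt_esize.
move=> x i; rewrite foldl_addnE add0n; apply: leq_trans (esize_take _ _ i).
rewrite esize_nat esize_seq ltnS; elim: (take _ _) => //= n s IH.
by rewrite big_cons esize_nat; lia.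
Qed.

Definition parity_half n : nat * bool :=
  iter n (fun p => if p.2 then (p.1.+1, false) else (p.1, true)) (0, false).

Lemma parity_halfE n : parity_half n = (n./2, odd n).
Proof.
elim: n => // n IH; rewrite /parity_half iterS -/(parity_half n) IH /=.
by rewrite uphalf_half; case: odd.
Qed.

Lemma pt_parity_half (n : C -> nat) : pt n -> pt (fun x => parity_half (n x)).
Proof.
move=> pn; apply: pt_iter => //; try pt_basic.
exists (fun x => esize (n x) + 4).
  by apply: pbound_add; [exact: pt_esize|exact: pbound_const].
move=> x i le_i; rewrite -/(parity_half i) parity_halfE esize_pair esize_nat.
by have := esize_bool (odd i); rewrite esize_nat; lia.
Qed.

End Arithmetic.

(** * The kernelization and its running time *)

Definition bmatrix := seq (seq bool).

Definition get (M : bmatrix) i j := nth false (nth [::] M i) j.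

(* If [R] describes the walks shorter than [i], the result describes those
   shorter than [i.+1]. *)
Definition walk_step (M R : bmatrix) : bmatrix :=
  [seq [seq (x == y) || has (fun z => get R x z && get M z y) (iota 0 (size M))
     | y <- iota 0 (size M)] | x <- iota 0 (size M)].

(** The empty matrix describes the walks shorter than 0. After as many rounds as there are vertices,
    all walks with fewer edges than vertices are covered, simple paths among them. *)
Definition reach (M : bmatrix) := iter (size M) (walk_step M) [::].

Definition mx_nonadj (M R : bmatrix) x y :=
  [&& get R x y, ~~ get M x y & x != y].

Definition mx_triangle (M R : bmatrix) v :=
  has (fun a => get R v a &&
    has (fun b => has (fun c => [&& get M a b, get M a c & get M b c])
      (iota 0 (size M))) (iota 0 (size M))) (iota 0 (size M)).

Section ReductionRule.
Variable h : rel nat.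

Definition boundary_count (S : seq nat) u :=
  sumn [seq count (fun y => [&& nbr h u x, ~~ nbr h u y & h x y]) S | x <- S].

Definition simplicial (S : seq nat) u :=
  all (fun x => all (fun y => nbr h u x && nbr h u y ==> nbr h x y) S) S.

Definition removable (S : seq nat) u :=
  simplicial S u && (boundary_count S u < count (nbr h u) S).

Definition remove (p : seq nat * nat) u :=
  ([seq y <- p.1 | ~~ nbr h u y], boundary_count p.1 u + p.2).

Definition reduce_step (p : seq nat * nat) :=
  if nilp [seq u <- p.1 | removable p.1 u] then p
  else remove p (head 0 [seq u <- p.1 | removable p.1 u]).

(** Every round that is not idle removes a vertex, so [size S] rounds reach a fixed point. *)
Definition reduce (S : seq nat) := iter (size S) reduce_step (S, 0).

Definition co_matrix (W : seq nat) : bmatrix :=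
  [seq [seq (x != y) && ~~ h x y | y <- W] | x <- W].

Lemma boundary_countE S u : boundary_count S u = boundary h S (nbr h u).
Proof.
rewrite /boundary_count /boundary sumnE big_map [RHS]big_mkcond /=.
apply: eq_bigr => x _; case: (nbr h u x); last exact: count_pred0.
rewrite -sum1_count [RHS]big_mkcond [LHS]big_mkcond.
by apply: eq_bigr => y _ /=; case: nbr => //=; case: (h x y).
Qed.

Definition removable_free S := ~~ has (removable S) S.

Lemma reduce_stepP p : removable_free p.1 /\ reduce_step p = p \/
  exists u, [/\ u \in p.1, removable p.1 u & reduce_step p = remove p u].
Proof.
rewrite /reduce_step /removable_free has_filter negbK -size_eq0 -/(nilp _).
case E : nilp; [by left|right].
set u := head _ _; exists u.
have : u \in [seq u <- p.1 | removable p.1 u].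
  by rewrite /u; move: E; case: [seq _ <- _ | _] => //= a l _; exact: mem_head.
by rewrite mem_filter => /andP[].
Qed.

(** A removed clique has more vertices than boundary edges, so the vertices left plus the budget
    spent never grow; this keeps the counter small throughout the iteration. *)
Lemma size_remove p u : removable p.1 u ->
  size (remove p u).1 < size p.1 /\
  size (remove p u).1 + (remove p u).2 <= size p.1 + p.2.
Proof.
case/andP=> _ lt; rewrite /remove /= size_filter.
have : count (nbr h u) p.1 + count (fun y => ~~ nbr h u y) p.1 = size p.1.
  exact: count_predC.
by move=> <-; move: lt; move: (count _ _) (count _ _) => a b; lia.
Qed.

Lemma reduce_step_size p :
  size (reduce_step p).1 + (reduce_step p).2 <= size p.1 + p.2.
Proof.
by case: (reduce_stepP p) => [[_ ->]|[u [_ ru ->]]] //; case: (size_remove ru).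
Qed.

Lemma subseq_reduce_step p : subseq (reduce_step p).1 p.1.
Proof.
case: (reduce_stepP p) => [[_ ->]|[u [_ ru ->]]] //; exact: filter_subseq.
Qed.

Lemma reduce_iterP S i (p := iter i reduce_step (S, 0)) :
  subseq p.1 S /\ size p.1 + p.2 <= size S.
Proof.
rewrite {}/p; elim: i => /= [|i [IH1 IH2]]; first by rewrite addn0.
split; first exact: subseq_trans (subseq_reduce_step _) IH1.
exact: leq_trans (reduce_step_size _) IH2.
Qed.

End ReductionRule.

(* The value of the binary number [s], capped to be representable in unary. *)
Definition clip cap (s : seq bool) :=
  foldl (fun v (b : bool) => minn (if b then v.*2.+1 else v.*2) cap) 0 (rev s).

Definition halve_step (p : nat * seq bool) :=
  if p.1 == 0 then p else ((parity_half p.1).1, (parity_half p.1).2 :: p.2).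

(** Halving [n] times surely reaches 0, where [halve_step] idles. Each digit is pushed on top of the
    lower ones, hence the reversal. *)
Definition binary n := rev (iter n halve_step (n, [::])).2.

Definition paw_matrix : bmatrix :=
  [:: [:: false; true; true; true]; [:: true; false; true; false];
      [:: true; true; false; false]; [:: true; false; false; false]].

(** If [p.1] is a yes-instance for the budget left, it has at most [2 * (k - p.2)] vertices;
    anything larger is replaced by a paw with budget zero. The numbers [n] and [n.+1] lie outside
    the vertex range and become the universal vertices. With no other vertex left they would form no
    triangle, hence the separate case. *)
Definition kernel_output (h : rel nat) n (S : seq nat) k : bmatrix * nat :=
  let p := reduce h S in
  if size p.1 + p.2.*2 <= k.*2 then
    if nilp p.1 then ([::], 0) else (co_matrix h [:: n, n.+1 & p.1], k - p.2)
  else (paw_matrix, 0).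

Definition kernel (I : bmatrix * seq bool) : bmatrix * nat :=
  let M := I.1 in let R := reach M in
  kernel_output (mx_nonadj M R) (size M)
    [seq v <- iota 0 (size M) | mx_triangle M R v]
    (* Adding [size M] once per row gives the square of the number of vertices without a
       multiplication. *)
    (clip (sumn [seq size M | _ <- M]) I.2).

(** * Running time of the kernelization *)

Lemma pt_app3 C D A1 A2 B (eC : encodable C) (eD : encodable D)
    (e1 : encodable A1) (e2 : encodable A2) (eB : encodable B)
    (h : C -> A1 -> A2 -> B) (f : D -> C) (a : D -> A1) (b : D -> A2) :
  pt (fun p : C * A1 * A2 => h p.1.1 p.1.2 p.2) -> pt f -> pt a -> pt b ->
  pt (fun x => h (f x) (a x) (b x)).
Proof.
move=> ph pf pa pb.
by apply: (pt_comp ph (pt_pair (pt_pair pf pa) pb)).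
Qed.

Ltac pt_list_step := cbv beta; lazymatch goal with
  | |- @pt _ _ _ _ (fun x => iota _ _) => apply: pt_iota
  | |- @pt _ _ _ _ (fun x => @map _ _ _ _) => apply: pt_map
  | |- @pt _ _ _ _ (fun x => @filter _ _ _) => apply: pt_filter
  | |- @pt _ _ _ _ (fun x => @has _ _ _) => apply: pt_has
  | |- @pt _ _ _ _ (fun x => @all _ _ _) => apply: pt_all
  | |- @pt _ _ _ _ (fun x => @count _ _ _) => apply: pt_count
  | |- @pt _ _ _ _ (fun x => sumn _) => apply: pt_sumn
  | |- @pt _ _ _ _ (fun x => @size _ _) => apply: pt_size
  | |- @pt _ _ _ _ (fun x => @rev _ _) => apply: pt_rev
  | |- @pt _ _ _ _ (fun x => parity_half _) => apply: pt_parity_half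
  | |- @pt _ _ _ _ (fun x => minn _ _) => apply: pt_minn
  | |- @pt _ _ _ _ (fun x => double _) => apply: pt_double
  | |- @pt _ _ _ _ (fun x => addn _ _) => apply: pt_add
  | |- @pt _ _ _ _ (fun x => subn _ _) => apply: pt_sub
  | |- @pt _ _ _ _ (fun x => leq _ _) => apply: pt_leq
  | |- @pt _ _ _ _ (fun x => @eq_op _ _ _) => apply: pt_eqn
  end.

Ltac pt_hyp := match goal with
  | H : @pt _ _ _ _ ?g |- @pt _ _ _ _ ?g => exact: H
  | H : @pt _ _ _ _ ?g |- @pt _ _ _ _ (fun x => ?g _) => apply: (pt_comp H)
  | H : @pt _ _ _ _ (fun p => ?h p.1.1 p.1.2 p.2) |-
      @pt _ _ _ _ (fun x => ?h _ _ _) => apply: (pt_app3 H)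
  end.

Ltac pt_solve := repeat first [pt_hyp | pt_basic_step | pt_list_step].

Section PolyTime.
Context {C : Type} {eC : encodable C}.

Lemma pt_get (M : C -> bmatrix) (i j : C -> nat) :
  pt M -> pt i -> pt j -> pt (fun x => get (M x) (i x) (j x)).
Proof. by move=> pM pi pj; do 2 apply: pt_nth => //. Qed.

Lemma pt_nbr (h : C -> rel nat) :
  pt (fun p : C * nat * nat => h p.1.1 p.1.2 p.2) ->
  pt (fun p : C * nat * nat => nbr (h p.1.1) p.1.2 p.2).
Proof. by move=> ph; rewrite /nbr; pt_solve. Qed.

End PolyTime.

Section PolyTime.
Context {C : Type} {eC : encodable C}.

Lemma pt_walk_step (M R : C -> bmatrix) :
  pt M -> pt R -> pt (fun x => walk_step (M x) (R x)).
Proof.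
move=> pM pR; rewrite /walk_step; pt_solve.
all: by apply: pt_get; pt_solve.
Qed.

Lemma pt_mx_triangle (M R : C -> bmatrix) (v : C -> nat) :
  pt M -> pt R -> pt v -> pt (fun x => mx_triangle (M x) (R x) (v x)).
Proof.
move=> pM pR pv; rewrite /mx_triangle; pt_solve.
all: by apply: pt_get; pt_solve.
Qed.

Lemma pt_mx_nonadj (M R : C -> bmatrix) (x y : C -> nat) :
  pt M -> pt R -> pt x -> pt y ->
  pt (fun z => mx_nonadj (M z) (R z) (x z) (y z)).
Proof.
move=> pM pR px py; rewrite /mx_nonadj; pt_solve.
all: by apply: pt_get; pt_solve.
Qed.

Variable h : C -> rel nat.
Hypothesis ph : pt (fun p : C * nat * nat => h p.1.1 p.1.2 p.2).

Lemma pt_boundary_count :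
  pt (fun p : C * seq nat * nat => boundary_count (h p.1.1) p.1.2 p.2).
Proof.
have pn := pt_nbr ph; rewrite /boundary_count.
pt_solve.
all: by apply: (pt_app3 (h := fun x => nbr (h x)) pn); pt_solve.
Qed.

Lemma pt_removable :
  pt (fun p : C * seq nat * nat => removable (h p.1.1) p.1.2 p.2).
Proof.
have pn := pt_nbr ph; have pb := pt_boundary_count.
rewrite /removable /simplicial; pt_solve.
all: by first [ apply: (pt_app3 (h := fun x => nbr (h x)) pn)
              | apply: (pt_app3 (h := fun x => boundary_count (h x)) pb)]; pt_solve.
Qed.

Lemma pt_reduce_step :
  pt (fun p : C * (seq nat * nat) => reduce_step (h p.1) p.2).
Proof.
have pr := pt_removable; have pb := pt_boundary_count; have pn := pt_nbr ph.
rewrite /reduce_step /remove; pt_solve.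
all: first [ apply: (pt_app3 (h := fun x => removable (h x)) pr)
           | apply: (pt_app3 (h := fun x => nbr (h x)) pn)
           | apply: (pt_app3 (h := fun x => boundary_count (h x)) pb)]; pt_solve.
all: by apply: (pt_app3 (h := fun x => removable (h x)) pr); pt_solve.
Qed.

End PolyTime.

Lemma esize_subseq_nat (s1 s2 : seq nat) : subseq s1 s2 -> esize s1 <= esize s2.
Proof.
case/subseqP => m _ ->; rewrite !esize_seq ltnS.
elim: s2 m => [|a s2 IH] [|[] m]; rewrite ?big_nil ?big_cons //= ?big_cons.
  by rewrite leq_add2l.
exact: leq_trans (IH m) (leq_addl _ _).
Qed.

Section PolyTime.
Context {C : Type} {eC : encodable C}.

(** Every iterate is empty or a square Boolean matrix with as many rows as the input, whatever the
    number of rounds. *)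
Lemma pt_reach (M : C -> bmatrix) : pt M -> pt (fun x => reach (M x)).
Proof.
move=> pM; rewrite /reach; apply: pt_iter; try by pt_solve.
  by apply: pt_walk_step; pt_solve.
have sM := pt_esize pM; have one := @pbound_const _ eC.
exists (fun x => esize (M x) * (esize (M x) * 4 + 2) + 1).
  by do ![apply: pbound_add => // | apply: pbound_mul => //].
move=> x [|i] _; first by rewrite addn1.
rewrite iterS /walk_step; set V := iota _ _.
have sV : size V <= esize (M x) by rewrite size_iota ltnW // size_esize.
apply: (leq_trans (@esize_map _ _ _ _ _ _ (size V * 4).+1 _)) => [a _|].
  by apply: esize_map => b _; apply: esize_bool.
by rewrite addn1 ltnS leq_mul // addn2 !ltnS leq_mul2r sV.
Qed.

Lemma pt_reduce (h : C -> rel nat) (S : C -> seq nat) :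
  pt (fun p : C * nat * nat => h p.1.1 p.1.2 p.2) -> pt S ->
  pt (fun x => reduce (h x) (S x)).
Proof.
move=> ph pS; rewrite /reduce; apply: pt_iter; try by pt_solve.
  exact: pt_reduce_step.
have sS := pt_esize pS.
exists (fun x => esize (S x) + (esize (S x) + esize (S x) + 1) + 1).
  by do ![apply: pbound_add => // | exact: pbound_const].
move=> x i _; have [sub le] := reduce_iterP (h x) (S x) i.
have := esize_subseq_nat sub; move: (iter _ _ _) le => p le.
have lt := size_esize encodable_nat (S x).
rewrite [p]surjective_pairing esize_pair esize_nat /=; lia.
Qed.

Lemma pt_co_matrix (h : C -> rel nat) (W : C -> seq nat) :
  pt (fun p : C * nat * nat => h p.1.1 p.1.2 p.2) -> pt W ->
  pt (fun x => co_matrix (h x) (W x)).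
Proof. by move=> ph pW; rewrite /co_matrix; pt_solve. Qed.

(** The number written by [s] may be exponential in the length of [s], but no intermediate value
    exceeds the cap. *)
Lemma pt_clip (cap : C -> nat) (s : C -> seq bool) :
  pt cap -> pt s -> pt (fun x => clip (cap x) (s x)).
Proof.
move=> pc ps; rewrite /clip; apply: pt_foldl; try by pt_solve.
have sc := pt_esize pc.
exists (fun x => esize (cap x)) => // x i.
suff : foldl (fun v (b : bool) => minn (if b then v.*2.+1 else v.*2) (cap x)) 0
  (take i (rev (s x))) <= cap x by rewrite !esize_nat; lia.
by elim/last_ind: (take _ _) => //= l b _; rewrite foldl_rcons geq_minr.
Qed.

Lemma halve_iterP n i (p := iter i halve_step (n, [::])) :
  p.1 <= n /\ size p.2 <= i.
Proof.
rewrite {}/p; elim: i => // i; rewrite iterS; move: (iter _ _ _) => p [IH1 IH2].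
rewrite /halve_step; case: eqP => _; first by split; [|apply: leqW].
rewrite parity_halfE; split=> //; apply: leq_trans IH1.
by rewrite leq_half_double -addnn -addnS leq_addr.
Qed.

Lemma pt_binary (n : C -> nat) : pt n -> pt (fun x => binary (n x)).
Proof.
move=> pn; rewrite /binary; apply: pt_rev; apply: pt_snd; apply: pt_iter.
- by [].
- by pt_solve.
- by rewrite /halve_step; pt_solve.
have sn := pt_esize pn.
exists (fun x => esize (n x) + (esize (n x) * 4 + 1) + 1).
  by do ![ apply: pbound_add => // | apply: pbound_mul => //
         | exact: pbound_const].
move=> x i le_i; have [] := halve_iterP (n x) i.
move: (iter _ _ _) => p le1 le2; rewrite [p]surjective_pairing esize_pair.
have := @esize_map _ _ _ _ id p.2 3 (fun b _ => esize_bool b).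
rewrite map_id => /(_ encodable_bool); by rewrite !esize_nat; lia.
Qed.

Lemma pt_kernel_output
    (h : C -> rel nat) (n : C -> nat) (S : C -> seq nat) (k : C -> nat) :
  pt (fun p : C * nat * nat => h p.1.1 p.1.2 p.2) -> pt n -> pt S -> pt k ->
  pt (fun x => kernel_output (h x) (n x) (S x) (k x)).
Proof.
move=> ph pn pS pk; have pr := pt_reduce ph pS; rewrite /kernel_output.
have pc : pt (fun x =>
    co_matrix (h x) [:: n x, (n x).+1 & (reduce (h x) (S x)).1]).
  by apply: pt_co_matrix => //; pt_solve.
by pt_solve.
Qed.

End PolyTime.

Lemma pt_kernel : pt (fun I : bmatrix * seq bool => kernel I).
Proof.
rewrite /kernel.
have p1 : pt (fun I : bmatrix * seq bool => I.1) by pt_solve.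
have p2 : pt (fun I : bmatrix * seq bool => I.2) by pt_solve.
apply: pt_kernel_output.
- by apply: pt_mx_nonadj; try apply: pt_reach; pt_solve.
- by pt_solve.
- by apply: pt_filter; [|apply: pt_mx_triangle; try apply: pt_reach]; pt_solve.
- by apply: pt_clip; pt_solve.
Qed.

(** * Correctness *)

Lemma bits0 : bits 0 = [::]. Proof. by rewrite /bits up_log1. Qed.

Lemma bitsE n : 0 < n -> bits n = odd n :: bits n./2.
Proof.
move=> n0; rewrite /bits up_log2S // /mkseq /= expn0 divn1; congr (_ :: _).
rewrite -[iota 1 _]/(iota (1 + 0) _) iotaDl -map_comp; apply: eq_map => i /=.
by rewrite add1n expnS divnMA divn2.
Qed.

(** Capping after every digit agrees with capping once at the end, since a value that has reached
    the cap cannot fall below it by doubling. *)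
Lemma clip_bits cap k : clip cap (bits k) = minn k cap.
Proof.
elim/ltn_ind: k => -[_|k IH]; first by rewrite bits0 /clip /= min0n.
rewrite bitsE // /clip rev_cons foldl_rcons -/(clip cap (bits _)) IH; last first.
  by have := odd_double_half k.+1; lia.
have := odd_double_half k.+1; case: odd; lia.
Qed.

Lemma binaryE n : binary n = bits n.
Proof.
(* The digits already emitted, followed by those of the remaining number, always spell [n]. *)
rewrite /binary; pose inv (p : nat * seq bool) := rev p.2 ++ bits p.1.
have invP i : inv (iter i halve_step (n, [::])) = bits n.
  elim: i => // i <-; rewrite iterS; move: (iter _ _ _) => p.
  rewrite /halve_step; case: eqP => // /eqP p0; rewrite parity_halfE /inv /=.
  by rewrite (@bitsE p.1) ?lt0n // rev_cons cat_rcons.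
have le i : (iter i halve_step (n, [::])).1 <= n - i.
  elim: i => [|i]; first by rewrite subn0.
  rewrite iterS; move: (iter _ _ _) => p; rewrite /halve_step.
  case: eqP => [-> //|p0]; rewrite parity_halfE /=.
  have := odd_double_half p.1; lia.
have := invP n; have := le n; rewrite subnn leqn0 /inv => /eqP->.
by rewrite bits0 cats0.
Qed.

Section ReduceCorrect.
Variable h : rel nat.
Hypothesis sym_h : symmetric h.
Implicit Types S : seq nat.

Lemma simplicialP S u :
  reflect (clique h (filter (nbr h u) S)) (simplicial h S u).
Proof.
apply: (iffP allP) => [H x y|H x xS].
  rewrite !mem_filter => /andP[nx xS] /andP[ny yS].
  by have /allP/(_ y yS) := H x xS; rewrite nx ny.
apply/allP => y yS; apply/implyP => /andP[nx ny].
by apply: H; rewrite mem_filter ?nx ?ny.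
Qed.

Lemma remove_correct p u k : removable h p.1 u ->
  p.2 <= k /\ cluster_deletion h p.1 (k - p.2) <->
  (remove h p u).2 <= k /\
  cluster_deletion h (remove h p u).1 (k - (remove h p u).2).
Proof.
case/andP=> /simplicialP cl; rewrite boundary_countE -size_filter => lt.
have R := clique_removal sym_h (k - p.2) cl lt.
rewrite /remove /= boundary_countE; split.
  case=> le /R[le' cd]; split; first lia.
  by rewrite addnC subnDA.
case=> le cd; split; first lia.
by apply/R; split; [lia|rewrite -subnDA addnC].
Qed.

Lemma reduce_iter_correct S i k (p := iter i (reduce_step h) (S, 0)) :
  cluster_deletion h S k <-> p.2 <= k /\ cluster_deletion h p.1 (k - p.2).
Proof.
rewrite {}/p; elim: i => [|i IH].
  by rewrite /= subn0; split=> [|[]].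
rewrite iterS IH; move: (iter _ _ _) => p.
by case: (reduce_stepP h p) => [[_ ->]|[u [_ ru ->]]] //; apply: remove_correct.
Qed.

Lemma reduce_irreducible S : removable_free h (reduce h S).1.
Proof.
have step i (p := iter i (reduce_step h) (S, 0)) :
    removable_free h p.1 \/ size p.1 <= size S - i.
  rewrite {}/p; elim: i => [|i]; first by right; rewrite subn0.
  rewrite iterS; move: (iter _ _ _) => p.
  case: (reduce_stepP h p) => [[free ->]|[u [up ru ->]]]; first by left.
  case=> [/hasP[]|le]; first by exists u.
  right; have [lt _] := size_remove ru; rewrite subnS -ltnS.
  by apply: leq_trans lt (leq_trans le (leqSpred _)).
case: (step (size S)) => //; rewrite subnn leqn0 size_eq0 -/(reduce h S).
by move=> /eqP->.
Qed.

Lemma reduced_small S k : removable_free h S ->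
  cluster_deletion h S k -> size S <= k.*2.
Proof.
move=> free; apply: irreducible_small => u uS cl.
rewrite leqNgt; apply: contra free => lt; apply/hasP; exists u => //.
by rewrite /removable boundary_countE -size_filter lt andbT; apply/simplicialP.
Qed.

(** An isolated vertex is a clique of size one with empty boundary, so [clique_removal] drops it at
    no cost. *)
Lemma add_isolated S a k : a \notin S -> (forall x, ~~ h a x) ->
  cluster_deletion h (a :: S) k <-> cluster_deletion h S k.
Proof.
move=> aS iso.
have E1 : filter (pred1 a) (a :: S) = [:: a].
  by rewrite /= eqxx (_ : filter _ S = [::]) //; apply/eqP;
     rewrite -(negbK (_ == _)) -has_filter has_pred1.
have E2 : filter (predC (pred1 a)) (a :: S) = S.
  rewrite /= eqxx /=; apply/all_filterP/allP => x xS /=.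
  by apply: contraNneq aS => <-.
have E3 : boundary h (a :: S) (pred1 a) = 0.
  rewrite boundaryE E1 E2 big_seq1 big1 // => x _.
  by rewrite (negbTE (iso x)).
have := clique_removal sym_h (S := a :: S) (P := pred1 a) k.
rewrite E1 E2 E3 subn0 => R; rewrite R //.
- by split=> [[]|].
- by move=> x y; rewrite !inE => /eqP-> /eqP->; rewrite eqxx.
Qed.

End ReduceCorrect.

(** * Graphs described by matrices *)

Definition matrix_rel (M : bmatrix) : rel 'I_(size M) :=
  fun i j => (i != j) && (get M i j || get M j i).

Lemma matrix_rel_sym M : symmetric (@matrix_rel M).
Proof. by move=> i j; rewrite /matrix_rel eq_sym orbC. Qed.

Lemma matrix_rel_irrefl M : irreflexive (@matrix_rel M).
Proof. by move=> i; rewrite /matrix_rel eqxx. Qed.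

(** Symmetry and irreflexivity are forced, so that every output of the program is a graph; on a
    [graph_matrix] this changes nothing. *)
Definition graph_of_matrix (M : bmatrix) : sgraph :=
  SGraph (@matrix_rel_sym M) (@matrix_rel_irrefl M).

Definition adjacency (G : sgraph) : bmatrix :=
  [seq [seq sedge x y | y <- enum G] | x <- enum G].

Definition graph_matrix (M : bmatrix) :=
  [/\ all (fun r => size r == size M) M,
      forall i, i < size M -> get M i i = false &
      forall i j, i < size M -> j < size M -> get M i j = get M j i].

(** Ordinals are enumerated in increasing order. Hence the matrix written by the program is
    literally the one by which its graph is encoded. *)
Lemma adjacency_graph_of_matrix M : graph_matrix M ->
  adjacency (graph_of_matrix M) = M.
Proof.
case=> /allP rows irr sym; rewrite /adjacency.
have sE : size (enum (graph_of_matrix M)) = size M by rewrite -cardE card_ord.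
apply: (@eq_from_nth _ [::]) => [|i]; first by rewrite size_map.
rewrite size_map sE => ltiM; pose i' : 'I_(size M) := Ordinal ltiM.
rewrite (nth_map i') ?sE //.
have sz : size (nth [::] M i) = size M by apply/eqP/rows/mem_nth.
apply: (@eq_from_nth _ false) => [|j]; first by rewrite size_map sz.
rewrite size_map sE => ltjM; pose j' : 'I_(size M) := Ordinal ltjM.
rewrite (nth_map i') ?sE //.
have -> : nth i' (enum (graph_of_matrix M)) i = i'.
  exact: (nth_ord_enum i' i').
have -> : nth i' (enum (graph_of_matrix M)) j = j'.
  exact: (nth_ord_enum i' j').
rewrite /= /matrix_rel -val_eqE /= -(sym i j) // orbb -/(get M i j).
by case: eqP => //= <-; rewrite irr.
Qed.

Section CoMatrix.
Variables (h : rel nat) (W : seq nat).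

Lemma size_co_matrix : size (co_matrix h W) = size W.
Proof. exact: size_map. Qed.

Lemma get_co_matrix i j : i < size W -> j < size W ->
  get (co_matrix h W) i j =
  (nth 0 W i != nth 0 W j) && ~~ h (nth 0 W i) (nth 0 W j).
Proof. by move=> iW jW; rewrite /get (nth_map 0) // (nth_map 0). Qed.

Lemma co_matrix_graph : symmetric h -> graph_matrix (co_matrix h W).
Proof.
move=> sym_h; split.
- by apply/allP => r /mapP[x _ ->]; rewrite size_map size_co_matrix.
- by move=> i; rewrite size_co_matrix => iW; rewrite get_co_matrix // eqxx.
- move=> i j; rewrite size_co_matrix => iW jW.
  by rewrite !get_co_matrix // eq_sym sym_h.
Qed.

End CoMatrix.

Lemma paw_matrix_graph : graph_matrix paw_matrix.
Proof.
by split=> // [[|[|[|[|i]]]]|[|[|[|[|i]]]] [|[|[|[|j]]]]].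
Qed.

Lemma paw_no_instance : ~ yes_instance (graph_of_matrix paw_matrix, 0).
Proof.
case=> F [_ /=]; rewrite leqn0 cards_eq0 => /eqP-> /paw_freeP pf.
pose o k (H : k < 4) : 'I_4 := Ordinal H.
have := pf (o 0 isT) (o 1 isT) (o 2 isT) (o 3 isT).
rewrite /= /add_edges_rel /= !inE /=.
by move=> /(_ isT isT isT isT isT isT).
Qed.

Lemma map_index_iota (T : eqType) (s : seq T) :
  uniq s -> map (index^~ s) s = iota 0 (size s).
Proof.
move=> us; apply: (@eq_from_nth _ 0) => [|i].
  by rewrite size_map size_iota.
rewrite size_map => lt; have x : T by case: s us lt.
by rewrite (nth_map x) // index_uniq // nth_iota.
Qed.

Lemma get_out M i j : size M <= i -> get M i j = false.
Proof. by move=> le; rewrite /get (nth_default [::]) // nth_nil. Qed.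

Lemma get_table n (E : nat -> nat -> bool) i j :
  get [seq [seq E x y | y <- iota 0 n] | x <- iota 0 n] i j =
  [&& i < n, j < n & E i j].
Proof.
case: (ltnP i n) => [lti|le]; last by rewrite get_out // size_map size_iota.
rewrite /get (nth_map 0) ?size_iota //.
case: (ltnP j n) => [ltj|le]; last by rewrite nth_default // size_map size_iota.
by rewrite (nth_map 0) ?size_iota // !nth_iota.
Qed.

(** * The cluster deletion instance read off an adjacency matrix *)

Section Adjacency.
Variable G : sgraph.
Let M := adjacency G.
Let num (x : G) := index x (enum G).

Lemma size_adjacency : size M = #|G|.
Proof. by rewrite size_map -cardE. Qed.

Let num_inj : injective num.
Proof.
move=> x y E; rewrite -(nth_index x (s := enum G) (x := x)) ?mem_enum //.
by rewrite -/(num x) E nth_index ?mem_enum.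
Qed.

Let num_lt x : num x < #|G|.
Proof. by rewrite cardE index_mem mem_enum. Qed.

Let iotaE : iota 0 #|G| = map num (enum G).
Proof. by rewrite (map_index_iota (enum_uniq _)) -cardE. Qed.

Let num_surj i : i < #|G| -> exists x, i = num x.
Proof.
move=> lt; have : i \in iota 0 #|G| by rewrite mem_iota.
by rewrite iotaE => /mapP[x _ ->]; exists x.
Qed.

Let has_iota (P : pred nat) : has P (iota 0 (size M)) = [exists x, P (num x)].
Proof.
rewrite size_adjacency iotaE has_map.
apply/hasP/existsP => [[x _ Px]|[x Px]]; exists x => //.
by rewrite mem_enum.
Qed.

Let get_adjacency x y : get M (num x) (num y) = sedge x y.
Proof.
rewrite /get (nth_map x) -?cardE ?num_lt // nth_index ?mem_enum //.
by rewrite (nth_map x) -?cardE ?num_lt // nth_index ?mem_enum.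
Qed.

Let get_walk_step R x y : get (walk_step M R) (num x) (num y) =
  (x == y) || [exists z, get R (num x) (num z) && sedge z y].
Proof.
rewrite get_table size_adjacency !num_lt /= (inj_eq num_inj); congr (_ || _).
rewrite -size_adjacency has_iota.
by apply: eq_existsb => z; rewrite get_adjacency.
Qed.

Let get_reach x y : get (reach M) (num x) (num y) = connect (@sedge G) x y.
Proof.
rewrite /reach size_adjacency; apply/idP/idP => [|/connectP[p0 pth ->]].
  elim: #|G| y => [|i IH] y; first by rewrite get_out.
  rewrite iterS get_walk_step => /orP[/eqP->//|/existsP[z /andP[/IH xz zy]]].
  exact: connect_trans xz (connect1 zy).
(* A path without repeated vertices has fewer edges than the graph has vertices, so the rounds
   suffice. *)
case/shortenP: pth => p pth up _.
have : size p < #|G|.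
  by rewrite -[(size p).+1]/(size (x :: p)) -(card_uniqP up) max_card.
elim: #|G| p pth {up} => // i IH p.
case/lastP: p => [|p z]; first by rewrite iterS get_walk_step eqxx.
rewrite rcons_path last_rcons size_rcons ltnS => /andP[pth zp] lt.
rewrite iterS get_walk_step; apply/orP; right.
by apply/existsP; exists (last x p); rewrite IH.
Qed.

Let h := mx_nonadj M (reach M).

Let hE x y : h (num x) (num y) = component_nonadj x y.
Proof.
by rewrite /h /mx_nonadj get_reach get_adjacency (inj_eq num_inj).
Qed.

Let h_out i j : ~~ ((i < #|G|) && (j < #|G|)) -> h i j = false.
Proof.
move=> out; rewrite /h /mx_nonadj /reach size_adjacency.
case E : #|G| => [|n]; first by rewrite get_out.
rewrite iterS get_table size_adjacency; apply/negP => /andP[/and3P[i1 j1 _] _].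
by move: out; rewrite i1 j1.
Qed.

Let h_sym : symmetric h.
Proof.
move=> i j; case: (boolP ((i < #|G|) && (j < #|G|))) => [|out].
  case/andP=> /num_surj[x ->] /num_surj[y ->].
  by rewrite !hE component_nonadj_sym.
by rewrite !h_out // andbC.
Qed.

Let triangleE v : mx_triangle M (reach M) (num v) = in_triangle_componentb v.
Proof.
rewrite /mx_triangle has_iota; apply: eq_existsb => a; rewrite get_reach.
congr (_ && _); rewrite has_iota; apply: eq_existsb => b.
by rewrite has_iota; apply: eq_existsb => c; rewrite !get_adjacency.
Qed.

(** The matrices are hidden behind properties of [h], [S] and [c]. That [h] vanishes from [#|G|] on
    makes the two numbers added later isolated. *)
Lemma adjacency_cluster_instance k :
  exists (h : rel nat) (S : seq nat) (c : nat),
  [/\ kernel (M, bits k) = kernel_output h #|G| S c,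
      [/\ symmetric h, irreflexive h & forall i j, #|G| <= i -> h i j = false],
      uniq S /\ {in S, forall i, i < #|G|},
      c <= k
    & yes_instance (G, k) <-> cluster_deletion h S c].
Proof.
exists h, (map num (triangle_vertices G)), (minn k (#|G| * #|G|)).
have SE : [seq v <- iota 0 (size M) | mx_triangle M (reach M) v] =
    map num (triangle_vertices G).
  rewrite size_adjacency iotaE filter_map; congr map.
  by apply: eq_filter => x /=; exact: triangleE.
split.
- rewrite /kernel /= SE clip_bits size_adjacency.
  congr (kernel_output _ _ _ (minn _ _)).
  by rewrite sumnE big_map big_const_seq count_predT iter_addn_0 size_adjacency.
- split; first exact: h_sym.
    by move=> i; rewrite /h /mx_nonadj eqxx !andbF.
  by move=> i j le; rewrite h_out // negb_and -leqNgt le.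
- split; first by rewrite map_inj_uniq // filter_uniq ?enum_uniq.
  by move=> i /mapP[x _ ->].
- exact: geq_minl.
rewrite yes_instance_cluster_deletion.
rewrite -(cluster_deletion_map (g := h) (f := num)) //.
  symmetry; apply: cluster_deletion_cap; rewrite size_map.
  have le : size (triangle_vertices G) <= #|G|.
    by rewrite cardE size_filter count_size.
  exact: leq_mul.
Qed.

End Adjacency.

(** * The output instance *)

Section Output.
Variables (h : rel nat) (n : nat) (S : seq nat) (k : nat).
Hypotheses (sym_h : symmetric h) (irr_h : irreflexive h).
Hypothesis h_out : forall i j, n <= i -> h i j = false.
Hypotheses (uniq_S : uniq S) (S_lt : {in S, forall i, i < n}).

(** Both [n] and [n.+1] are isolated for [h], hence universal in the complement, and any vertex of
    [T] completes a triangle with them. So [W] is a single triangle component whose non-adjacency is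
    [h], and [add_isolated] discards the two extra vertices. *)
Lemma co_matrix_instance (T : seq nat) c :
  T != [::] -> uniq T -> {in T, forall i, i < n} ->
  yes_instance (graph_of_matrix (co_matrix h [:: n, n.+1 & T]), c) <->
  cluster_deletion h T c.
Proof.
move=> T0 uT T_lt; set W := [:: n, n.+1 & T]; set M := co_matrix h W.
have nT i : n <= i -> i \notin T.
  by move=> le; apply/negP => /T_lt; rewrite ltnNge le.
have uW : uniq W by rewrite /= inE negb_or uT !nT // neq_ltn ltnS leqnn.
rewrite yes_instance_cluster_deletion.
set G := graph_of_matrix M; pose w (i : G) := nth 0 W (i : 'I_(size M)).
have sW : size M = size W by apply: size_co_matrix.
have ltW (i : G) : (i : 'I_(size M)) < size W by rewrite -sW.
have winj : injective w.
  by move=> i j /eqP; rewrite nth_uniq // => /eqP/ord_inj.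
have eE (i j : G) : sedge i j = (i != j) && ~~ h (w i) (w j).
  rewrite /= /matrix_rel; case: eqP => //= neq.
  rewrite !get_co_matrix // -!/(w _) !(inj_eq winj) [j == i]eq_sym.
  by rewrite [h (w j) _]sym_h orbb; case: eqP.
have oP k' : k' < 3 -> k' < size M.
  have T1 : 0 < size T by rewrite lt0n size_eq0.
  by move=> lt; rewrite sW (leq_trans lt) // !ltnS.
pose o k' (lt : k' < 3) : G := Ordinal (oP k' lt).
pose v0 := o 0 isT; pose v1 := o 1 isT; pose v2 := o 2 isT.
have e0 (i : G) : i != v0 -> sedge v0 i.
  by move=> i0; rewrite eE eq_sym i0 /w /= h_out.
have e1 (i : G) : i != v1 -> sedge v1 i.
  by move=> i1; rewrite eE eq_sym i1 /w /= h_out.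
have conn0 (i : G) : connect (@sedge G) v0 i.
  by have [->|/e0/connect1] := eqVneq i v0.
have conn (i j : G) : connect (@sedge G) i j.
  apply: connect_trans (conn0 j).
  by rewrite (sym_connect_sym (@sedge_sym G)).
have tv : triangle_vertices G = enum G.
  apply/all_filterP/allP => i _; apply/in_triangle_componentP.
  exists v0; first exact: conn.
  by exists v1, v2; split; [apply: e0|apply: e0|apply: e1].
have Wmap : map w (enum G) = W.
  apply: (@eq_from_nth _ 0) => [|i]; first by rewrite size_map -cardE card_ord.
  rewrite size_map -cardE card_ord => lt.
  rewrite (nth_map (Ordinal lt : G)) -?cardE ?card_ord //.
  by rewrite /w (nth_ord_enum _ (Ordinal lt)).
rewrite tv -(cluster_deletion_map (g := h) (f := w)) // => [|i j _ _].
  rewrite Wmap /W !add_isolated //.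
  - exact: nT.
  - by move=> x; rewrite h_out.
  - by rewrite inE negb_or nT // neq_ltn ltnS leqnn.
  - by move=> x; rewrite h_out.
rewrite /component_nonadj conn eE /= negb_and !negbK.
by have [->|_] := eqVneq i j; rewrite ?irr_h ?andbT.
Qed.

Lemma kernel_outputP M c : kernel_output h n S k = (M, c) ->
  [/\ graph_matrix M, c <= k,
      size M <= 38 * k \/ [/\ k = 0, ~ cluster_deletion h S k & size M <= 4]
    & cluster_deletion h S k <-> yes_instance (graph_of_matrix M, c)].
Proof.
rewrite /kernel_output; have [sub _] := reduce_iterP h S (size S).
rewrite -/(reduce h S) in sub; have irred := reduce_irreducible h S.
have R := reduce_iter_correct sym_h S (size S) k; rewrite -/(reduce h S) in R.
move: (reduce h S) sub irred R => p sub irred R.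
case: leqP => [small|large]; last first.
  have no : ~ cluster_deletion h S k.
    by rewrite R => -[le /(reduced_small irred)]; lia.
  case=> <- <-; split=> //; first exact: paw_matrix_graph.
    (* The four vertices of the paw fit in [38 * k] unless [k = 0]. *)
    by case: (k) no => [|k'] no; [right|left; rewrite /=; lia].
  by split=> // /paw_no_instance.
case: nilP => [p0|/eqP p0] [<- <-].
  split=> //; first by left.
  rewrite R p0; split=> _; last first.
    split; first by move: small; rewrite p0 /=; lia.
    by exists (fun=> 0) => //; rewrite /splits big_nil.
  rewrite yes_instance_cluster_deletion.
  have -> : triangle_vertices (graph_of_matrix [::]) = [::].
    apply/eqP; rewrite -size_eq0 -leqn0 size_filter.
    by rewrite (leq_trans (count_size _ _)) // -cardE card_ord.
  by exists (fun=> 0) => //; rewrite /splits big_nil.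
have sub' := mem_subseq sub.
split.
- exact: co_matrix_graph.
- exact: leq_subr.
(* A vertex is left, so [small] forces [k >= 1], and then [2 * k + 2 <= 38 * k]. *)
- left; have : 0 < size p.1 by rewrite lt0n size_eq0.
  rewrite size_co_matrix /=; lia.
rewrite co_matrix_instance //.
- by rewrite R; split=> [[]|cd] //; split=> //; lia.
- exact: subseq_uniq sub uniq_S.
- by move=> i /sub'/S_lt.
Qed.

End Output.

Definition kernelize (I : instance) : instance :=
  let r := kernel (adjacency I.1, bits I.2) in (graph_of_matrix r.1, r.2).

Lemma kernel_graph_matrix I : graph_matrix (kernel (adjacency I.1, bits I.2)).1.
Proof.
case: I => G k /=.
have [h [S [c [-> [sh ih oh] [uS lS] _ _]]]] := adjacency_cluster_instance G k.
by case E : kernel_output => [M c']; case: (kernel_outputP sh ih oh uS lS E).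
Qed.

Lemma polytime_pt A B (eA : encodable A) (eB : encodable B) C D
    (encC : C -> tree) (encD : D -> tree) (f : A -> B) (g : C -> D)
    (inj : C -> A) :
  (forall x, encC x = enc (inj x)) ->
  (forall x, encD (g x) = enc (f (inj x))) ->
  pt f -> polytime encC encD g.
Proof.
move=> inE outE [c] [m] [p] [[d bp] H].
(* With [N >= 1] the size of the input, [(N + 1) ^ d <= 2 ^ d * N ^ d]. *)
exists c, (2 ^ d), d => x.
have [t [s [ex s0 _ le_t]]] := H (inj x) (upd (fun=> Leaf) 0 (enc (inj x))) erefl.
exists t; first by exists s; rewrite ?inE // s0 outE.
apply: leq_trans le_t (leq_trans (bp _) _); rewrite inE -/(esize _).
apply: leq_trans (leq_addr _ _); rewrite -expnMn; apply: leq_exp1.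
by have := esize_gt0 eA (inj x); lia.
Qed.

Theorem theorem1 :
  exists f : instance -> instance,
    polytime enc_instance enc_instance f /\
    forall (G : sgraph) (k : nat) (G' : sgraph) (k' : nat),
      f (G, k) = (G', k') ->
      [/\ k' <= k,
          (* no no-instance has 0 = 38 * 0 vertices, whence the exception *)
          #|G'| <= 38 * k \/ [/\ k = 0, ~ yes_instance (G, k) & #|G'| <= 4]
        & yes_instance (G, k) <-> yes_instance (G', k')].
Proof.
exists kernelize; split.
  have pk := pt_kernel.
  apply: (@polytime_pt _ _ _ _ _ _ _ _
    (fun I : bmatrix * seq bool => ((kernel I).1, binary (kernel I).2)) _
    (fun I => (adjacency I.1, bits I.2))) => // [I|].
    have := adjacency_graph_of_matrix (kernel_graph_matrix I).
    rewrite /kernelize; case: kernel => M c /= ME.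
    by rewrite binaryE -[in RHS]ME.
  by apply: pt_pair; [apply: pt_fst|apply: pt_binary; apply: pt_snd].
move=> G k G' k' [].
have [h [S [c [-> [sh ih oh] [uS lS] ck yes]]]] := adjacency_cluster_instance G k.
case E : kernel_output => [M c'] /= <- <-.
have [_ c'c size_M cd] := kernel_outputP sh ih oh uS lS E.
split; first exact: leq_trans c'c ck.
  rewrite card_ord; case: size_M => [le|[c0 no le]].
    by left; apply: leq_trans le _; rewrite leq_mul2l ck.
  (* The capped parameter [c] may vanish although [k] does not; four vertices then fit in
     [38 * k]. *)
  case: (posnP k) => [k0|k_gt0]; last by left; lia.
  by right; split=> //; rewrite yes.
by rewrite yes.
Qed.
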